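(* For each of the three platonic Picard–Fuchs operators $L_{\mathbb T},L_{\mathbb O},L_{\mathbb I}$ (see context) and each finite singular point $\alpha$ of it, shift $\alpha$ to the origin and scale critically, i.e. replace $t$ by $\alpha+\lambda t$ for a suitable $\lambda\in\mathbb{C}^*$ (and multiply by a function of $t$ from the left). In this way one obtains the following $8$ critically scaled operators, where the named fibre is the one moved to $0$; the unique power series solution $\phi(t)=\sum_{n\ge0} a_nt^n$ with $a_0=1$ of each operator has integer coefficients, beginning as listed. $\mathbb{T}(3)$ (either of the two $I_3$-fibres of $L_{\mathbb T}$): $2\theta^2-3t(27\theta^2+27\theta+8)+3^6t^2(\theta+\frac23)(\theta+\frac43)$; $1,12,198,3720,75690,1626912,36376704,837364176,\dots$ $\mathbb{T}(2)$ (the $I_2$-fibre of $L_{\mathbb T}$): $\theta^2-3^4t^2(\theta+\frac23)(\theta+\frac43)$; $1,0,18,0,810,0,45360,0,2806650,0,183891708,0,\dots$ $\mathbb{O}(4)$ (the $I_4$-fibre of $L_{\mathbb O}$): $3\theta^2-4t(28\theta^2+28\theta+9)+2^{10}t^2(\theta+\frac34)(\theta+\frac54)$; $1,12,180,2928,49860,875952,15754704,288722880,\dots$ $\mathbb{O}(3)$ (the $I_3$-fibre of $L_{\mathbb O}$): $\theta^2-2t(10\theta^2+10\theta+3)+2^6t^2(\theta+\frac34)(\theta+\frac54)$; $1,6,54,588,7110,91476,1224636,16849944,236523078,\dots$ $\mathbb{O}(2)$ (the $I_2$-fibre of $L_{\mathbb O}$): $3\theta^2-4t(32\theta^2+32\theta+9)-2^{12}t^2(\theta+\frac34)(\theta+\frac54)$;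 $1,12,612,25392,1298340,67041072,3633970704,\dots$ $\mathbb{I}(5)$ (the $I_5$-fibre of $L_{\mathbb I}$): $2\theta^2-t(59\theta^2+59\theta+20)+2^43^3t^2(\theta+\frac56)(\theta+\frac76)$; $1,10,120,1540,20500,279480,3876600,54496200,\dots$ $\mathbb{I}(3)$ (the $I_3$-fibre of $L_{\mathbb I}$): $10\theta^2-3t(333\theta^2+333\theta+100)+2^4 3^6t^2(\theta+\frac56)(\theta+\frac76)$; $1,30,1440,85260,5606100,391231080,28360117800,\dots$ $\mathbb{I}(2)$ (the $I_2$-fibre of $L_{\mathbb I}$): $5\theta^2-4t(88\theta^2+88\theta+25)-2^83^3t^2(\theta+\frac56)(\theta+\frac76)$; $1,20,1140,68240,4572100,321427920,23420014800,\dots$ The singular points and corresponding Kodaira fibres of these operators are: $\mathbb{T}(3)$: $I_2(\frac1{27}),I_3(\frac2{27}),I_3(0),IV(\infty)$; $\mathbb{T}(2)$: $I_2(0),I_3(\frac19),I_3(-\frac19),IV(\infty)$; $\mathbb{O}(4)$: $I_2(\frac3{64}),I_3(\frac1{16}),I_4(0),III(\infty)$; $\mathbb{O}(3)$: $I_2(\frac1{16}),I_3(0),I_4(\frac14),III(\infty)$; $\mathbb{O}(2)$: $I_2(0),I_3(\frac1{64}),I_4(-\frac3{64}),III(\infty)$; $\mathbb{I}(5)$: $I_2(\frac1{16}),I_3(\frac2{27}),I_5(0),II(\infty)$; $\mathbb{I}(3)$: $I_2(\frac{2\cdot 5}{864}),I_3(0),I_5(\frac2{27}),II(\infty)$; $\mathbb{I}(2)$: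 $I_2(0),I_3(\frac5{432}),I_5(-\frac1{16}),II(\infty)$.
   Context: $\theta=t\frac{d}{dt}$. For a fixed $r\neq 0$ (the value of $r$ is irrelevant up to scaling $t$) the platonic Picard–Fuchs operators are $$L_{\mathbb T}=r^3\theta^2-27t^2(\theta+\tfrac23)(\theta+\tfrac43),$$ $$L_{\mathbb O}=4r^4\theta^2-r^2t(28\theta^2+28\theta+9)+48t^2(\theta+\tfrac34)(\theta+\tfrac54),$$ $$L_{\mathbb I}=20r^6\theta^2+r^3t(88\theta^2+88\theta+25)-108t^2(\theta+\tfrac56)(\theta+\tfrac76).$$ They are the Picard–Fuchs operators of the tetrahedral, octahedral, icosahedral elliptic surfaces, whose fibres over the singular points are: for $L_{\mathbb T}$: $I_2$ at $0$, $I_3$ at $\pm(r/3)^{3/2}$, $IV$ at $\infty$; for $L_{\mathbb O}$: $I_4$ at $0$, $I_2$ at $r^2/4$, $I_3$ at $r^2/3$, $III$ at $\infty$; for $L_{\mathbb I}$: $I_2$ at $0$, $I_3$ at $-5r^3/27$, $I_5$ at $r^3$, $II$ at $\infty$. An operator with unique holomorphic solution $\phi(t)=\sum a_nt^n$, $a_0=1$, at $0$ is called critically scaled if $\phi(t)\in\mathbb{Z}[[t]]$, $\phi(t/k)\notin\mathbb{Z}[[t]]$ for all integers $k>1$, and $a_1\ge 0$. Two operators that differ by left multiplication with a non-zero function of $t$ are identified. *)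

(* Defs.v *)
From Stdlib Require Import BinNat.
From mathcomp Require Import all_boot all_order all_algebra.
From mathcomp Require Import complex.

Set Implicit Arguments.
Unset Strict Implicit.
Unset Printing Implicit Defensive.

Import Order.TTheory GRing.Theory Num.Theory.
Local Open Scope ring_scope.

(** * Linear differential operators with polynomial coefficients *)

(** [L : diffop F] stands for \sum_j L`_j(t) D^j with D = d/dt: the outer
    variable of the bivariate polynomial is D, and coefficients are written to
    the left of D. The commutative product of {poly {poly F}} is therefore not
    the composition of operators, which is [dmul]; but [p *: L] is the left
    multiplication of L by the function p(t). *)
Notation diffop F := {poly {poly F}}.

Section DiffOp.
Variable F : numFieldType.
Implicit Types (L M : diffop F) (a phi : nat -> F).

(** D o L, by the Leibniz rule D o c(t) = c'(t) + c(t) D. *)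
Definition Dmul L : diffop F := map_poly (@deriv F) L + L * 'X.

Definition dmul L M : diffop F := \sum_(j < size L) L`_j *: iter j Dmul M.

Definition theta : diffop F := 'X *: 'X.

(** The operator \sum_j P`_j(t) theta^j: in P the outer variable is theta. *)
Definition of_theta (P : {poly {poly F}}) : diffop F :=
  \sum_(j < size P) P`_j *: iter j (dmul theta) 1.

(** L and M differ by left multiplication with a non-zero rational function. *)
Definition left_equiv L M : Prop :=
  exists p q : {poly F}, [/\ p != 0, q != 0 & p *: L = q *: M].

(** Substitution of alpha + lambda t for t, under which D becomes
    lambda^-1 D. *)
Definition affine (alpha lambda : F) : {poly F} := alpha%:P + lambda *: 'X.

Definition shift_op (alpha lambda : F) L : diffop F :=
  \poly_(j < size L) (lambda ^- j *: (L`_j \Po affine alpha lambda)).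

(** Substitution of 1/t for t, under which D becomes - t^2 D. The result is
    multiplied from the left by t^N to clear denominators. *)
Definition op_at_infty L : diffop F :=
  let N := (\max_(j < size L) size (L`_j)%R)%N in
  \sum_(j < size L)
    (\poly_(i < N.+1) L`_j`_(N - i)%N) *: iter j (dmul (- 'X^2 *: 'X)) 1.

(** Some quotient L`_j / lead_coef L has a pole at alpha. *)
Definition finite_singular L (alpha : F) : bool :=
  [exists j : 'I_(size L),
    ~~ (('X - alpha%:P) ^+ mup alpha (lead_coef L) %| L`_j)].

(** Points of the projective line: [None] is the point at infinity. *)
Definition singular L (x : option F) : bool :=
  if x is Some alpha then finite_singular L alpha
  else finite_singular (op_at_infty L) 0.

(** ** Power series solutions at 0 *)

(** A power series is given by the sequence of its coefficients. *)
Definition ser_deriv a : nat -> F := fun n => n.+1%:R * a n.+1.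

Definition apply_op L a : nat -> F := fun n =>
  \sum_(j < size L) \sum_(i < n.+1) L`_j`_i * iter j ser_deriv a (n - i)%N.

Definition normalized_solution L a : Prop :=
  a 0%N = 1 /\ forall n, apply_op L a n = 0.

(** Positive radius of convergence. *)
Definition convergent a : Prop :=
  exists M rho : F, forall n, `|a n| <= M * rho ^+ n.

Definition unique_solution L phi : Prop :=
  [/\ normalized_solution L phi, convergent phi &
      forall a, normalized_solution L a -> a =1 phi].

Definition integral a : Prop := forall n, exists z : int, a n = z%:~R.

Definition critically_scaled L : Prop :=
  exists phi, [/\ unique_solution L phi, integral phi,
    forall k : nat, (1 < k)%N -> ~ integral (fun n => phi n / k%:R ^+ n) &
    0 <= phi 1%N].

(** The list is made of binary numbers because some of its entries are too
    large to be written as unary ones. *)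
Definition begins_with phi (s : seq N) : Prop :=
  forall i, (i < size s)%N -> phi i = (nat_of_bin (nth 0%num s i))%:R.

End DiffOp.

(** * Elliptic surfaces over the projective line *)

(** The Weierstrass model y^2 = 4 x^3 - g2(t) x - g3(t). *)
Record weierstrass (F : nzRingType) :=
  Weierstrass { g2 : {poly F}; g3 : {poly F} }.

Inductive kodaira :=
  | KI of nat | KII | KIII | KIV | KIstar of nat | KIVstar | KIIIstar | KIIstar.

Section EllipticSurfaces.
Variable F : numFieldType.
Implicit Types (S : weierstrass F) (L : diffop F).

Definition disc S : {poly F} := g2 S ^+ 3 - 27 *: g3 S ^+ 2.

Definition shift_surface (alpha lambda : F) S : weierstrass F :=
  Weierstrass (g2 S \Po affine alpha lambda) (g3 S \Po affine alpha lambda).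

(** ** Kodaira fibres *)

(** The model in a local coordinate s vanishing at the point. At infinity
    s = 1/t, and (x, y) is replaced by (s^(2N) x, s^(3N) y) with N large enough
    for the model to be polynomial in s. *)
Definition local_model S (x : option F) : weierstrass F :=
  if x is Some alpha then shift_surface alpha 1 S
  else let N := maxn (size (g2 S)) (size (g3 S)) in
    Weierstrass (\poly_(i < ((4 * N).+1)%N) (g2 S)`_(4 * N - i)%N)
                (\poly_(i < ((6 * N).+1)%N) (g3 S)`_(6 * N - i)%N).

Definition ord_ge (p : {poly F}) n : bool := 'X^n %| p.
Definition ord_eq (p : {poly F}) n : bool := ord_ge p n && ~~ ord_ge p n.+1.

(** Tate's table for the fibre at t = 0 of a model that is minimal at 0. *)
Definition tate_table S (K : kodaira) : bool :=
  match K with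
  | KI 0 => ord_eq (disc S) 0
  | KI n => [&& ord_eq (g2 S) 0, ord_eq (g3 S) 0 & ord_eq (disc S) n]
  | KII => [&& ord_ge (g2 S) 1, ord_eq (g3 S) 1 & ord_eq (disc S) 2]
  | KIII => [&& ord_eq (g2 S) 1, ord_ge (g3 S) 2 & ord_eq (disc S) 3]
  | KIV => [&& ord_ge (g2 S) 2, ord_eq (g3 S) 2 & ord_eq (disc S) 4]
  | KIstar 0 => [&& ord_ge (g2 S) 2, ord_ge (g3 S) 3 & ord_eq (disc S) 6]
  | KIstar n => [&& ord_eq (g2 S) 2, ord_eq (g3 S) 3 & ord_eq (disc S) (6 + n)%N]
  | KIVstar => [&& ord_ge (g2 S) 3, ord_eq (g3 S) 4 & ord_eq (disc S) 8]
  | KIIIstar => [&& ord_eq (g2 S) 3, ord_ge (g3 S) 5 & ord_eq (disc S) 9]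
  | KIIstar => [&& ord_ge (g2 S) 4, ord_eq (g3 S) 5 & ord_eq (disc S) 10]
  end.

(** The fibre over x of the minimal elliptic surface with model S: the table is
    applied after reduction to a minimal model (g2 / s^(4k), g3 / s^(6k)). *)
Definition has_fibre S (x : option F) (K : kodaira) : Prop :=
  exists k (S0 : weierstrass F),
    [/\ g2 (local_model S x) = 'X^(4 * k)%N * g2 S0,
        g3 (local_model S x) = 'X^(6 * k)%N * g3 S0 & tate_table S0 K].

Fixpoint has_fibres S (l : seq (option F * kodaira)) : Prop :=
  if l is (x, K) :: l' then has_fibre S x K /\ has_fibres S l' else True.

(** ** Picard-Fuchs operators *)

(** 4 x^3 - g2 x - g3, a polynomial in x with coefficients in F[t]. *)
Definition cubic S : {poly {poly F}} :=
  4 *: 'X^3 - g2 S *: 'X - (g3 S)%:P.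

(** With f = cubic S, one has D^j (f^(-1/2)) = P_j f^(-1/2 - j), where P_j is
    the following polynomial in x. *)
Fixpoint period_num S j : {poly {poly F}} :=
  if j is i.+1 then
    map_poly (@deriv F) (period_num S i) * cubic S
      - (i%:R + 2^-1 : F)%:P *: (map_poly (@deriv F) (cubic S) * period_num S i)
  else 1.

(** L annihilates the periods of dx/y, i.e. L(dx/y) is exact on the generic
    fibre: up to a factor q(t), L(f^(-1/2)) is the x-derivative of
    h(x) f^(1/2 - N) for some N. *)
Definition annihilates_periods L S : Prop :=
  exists (q : {poly F}) (h : {poly {poly F}}) (N : nat),
    [/\ q != 0, (size L <= N.+1)%N &
        q *: (\sum_(j < size L) L`_j *: (period_num S j * cubic S ^+ (N - j)%N))
        = h^`() * cubic S + (2^-1 - N%:R : F)%:P *: (h * (cubic S)^`())].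

(** The non-zero operator of least order annihilating the periods. *)
Definition picard_fuchs S L : Prop :=
  [/\ L != 0, annihilates_periods L S &
      forall L', L' != 0 -> annihilates_periods L' S -> (size L <= size L')%N].

(** S is an elliptic surface with Picard-Fuchs operator L and the listed
    fibres. *)
Definition surface_of L (l : seq (option F * kodaira)) S : Prop :=
  [/\ disc S != 0, picard_fuchs S L & has_fibres S l].

End EllipticSurfaces.

(** * The platonic operators *)

Section Platonic.
Variable F : numFieldType.

(** To be used in the argument of [of_theta]: the variables t and theta, and
    constants. *)
Definition pt : {poly {poly F}} := 'X%:P.
Definition ptheta : {poly {poly F}} := 'X.
Definition pcst (c : F) : {poly {poly F}} := c%:P%:P.

Local Notation t := pt.
Local Notation th := ptheta.
Local Notation "c %:C" := (pcst c).

Variable r : F.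

Definition L_T : diffop F := of_theta
  ((r ^+ 3)%:C * th ^+ 2
   - 27 * t ^+ 2 * (th + (2 / 3)%:C) * (th + (4 / 3)%:C)).

Definition L_O : diffop F := of_theta
  (4 * (r ^+ 4)%:C * th ^+ 2
   - (r ^+ 2)%:C * t * (28 * th ^+ 2 + 28 * th + 9)
   + 48 * t ^+ 2 * (th + (3 / 4)%:C) * (th + (5 / 4)%:C)).

Definition L_I : diffop F := of_theta
  (20 * (r ^+ 6)%:C * th ^+ 2
   + (r ^+ 3)%:C * t * (88 * th ^+ 2 + 88 * th + 25)
   - 108 * t ^+ 2 * (th + (5 / 6)%:C) * (th + (7 / 6)%:C)).

(** The fibres over the singular points; rho is a choice of (r/3)^(3/2).
    Surfaces satisfying [surface_of L_T (fibres_T rho)],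
    [surface_of L_O fibres_O] and [surface_of L_I fibres_I] are respectively the
    Weierstrass models of
      y^2 + r x y + (r^3/27 - t^2) y = x^3,
      y^2 = x^3 + r (r^2 - 9t/2) x^2 - (27/16) t^2 (r^2 - 4t) x,
      y^2 = 4 x^3 - 12 G(t/r^3) x - 8 H(t/r^3), where
      G = 1 + 5t + 115t^2 + 135t^3 and
      H = 1 + (15/2)t - 240t^2 - 935t^3 - 2565t^4 - (729/2)t^5. *)
Definition fibres_T (rho : F) : seq (option F * kodaira) :=
  [:: (Some 0, KI 2); (Some rho, KI 3); (Some (- rho), KI 3); (None, KIV)].

Definition fibres_O : seq (option F * kodaira) :=
  [:: (Some 0, KI 4); (Some (r ^+ 2 / 4), KI 2); (Some (r ^+ 2 / 3), KI 3);
      (None, KIII)].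

Definition fibres_I : seq (option F * kodaira) :=
  [:: (Some 0, KI 2); (Some (- 5 * r ^+ 3 / 27), KI 3); (Some (r ^+ 3), KI 5);
      (None, KII)].

End Platonic.

(** The singular points of L are exactly those listed. *)
Definition singular_points (F : numFieldType) (L : diffop F)
    (l : seq (option F * kodaira)) : Prop :=
  forall x, singular L x = (x \in unzip1 l).

(** Moving the singular point alpha of L to 0 and scaling suitably yields the
    critically scaled operator M, whose normalized solution begins with the
    coefficients s; this takes an elliptic surface with Picard-Fuchs operator L
    and fibres l to one with Picard-Fuchs operator M and fibres l', located at
    the singular points of M. *)
Definition critical_shift (F : numFieldType) (L : diffop F)
    (l : seq (option F * kodaira)) (alpha : F)
    (M : diffop F) (s : seq N) (l' : seq (option F * kodaira)) : Prop :=
  exists2 lambda : F, lambda != 0 &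
    [/\ left_equiv (shift_op alpha lambda L) M,
        critically_scaled M,
        exists phi, [/\ unique_solution M phi, integral phi
                      & begins_with phi s],
        singular_points M l' &
        forall S, surface_of L l S ->
          surface_of M l' (shift_surface alpha lambda S)].

(* Main.v *)
Require Import Defs.
From HB Require Import structures.
From Stdlib Require Import BinNat BinInt.
From mathcomp Require Import all_boot all_order all_algebra.
From mathcomp Require Import complex reals.
From mathcomp Require Import boolp ring zify ssrZ.

Set Implicit Arguments.
Unset Strict Implicit.
Unset Printing Implicit Defensive.

Import Order.TTheory GRing.Theory Num.Theory.
Local Open Scope ring_scope.

(** Every operator M of the list is t o (D o Q o D + q) with Q = t P, P quadratic
    and q linear, equivalently theta o P o theta + t q. In this form a shift is
    a substitution in Q and q, and the singular points are the roots of Q and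
    infinity. Substitution also transports Picard-Fuchs operators and Kodaira
    fibres, so that nothing has to be known about the elliptic surfaces.

    For the integrality, the period is a hypergeometric pull-back u * \sum_n c_n z^n.
    Here u is 1 in the tetrahedral case, a^(-1/2) for the octahedral model
    y^2 = x^3 + a x^2 + b x, and g2^(-1/4) in the icosahedral case, with a and g2
    normalized to be 1 at the shifted origin; z is a multiple of 1/j or of its
    analogue for curves with a torsion point of order 2 or 3; and c_n is
    (3n)!/n!^3, (4n)!/((2n)! n!^2) or 12^n \prod_(k < n) (12k + 1)(12k + 5) / n!^2.
    Applied to u z^n, the operator gives a combination of u z^n and u z^(n+1)
    for which the sum telescopes. All factors are integral: a (resp. g2) is 1
    modulo 4 (resp. 8), hence the square (resp. fourth power) of an integral
    series. *)

(** * Power series *)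

(** The recurrence for the coefficients divides by [c0 * (n + 1)^2] at each step: it determines the
    solution and bounds its growth, but shows nothing about integrality. Hence the closed form. Its
    geometric origin only serves to find the polynomials; what is verified are a few polynomial
    identities. In them [h] is P(0) times the order of z at 0, as the lowest coefficients in P *
    theta(z) = K * z show. Critical scaling quantifies over all k > 1. If phi(t/k) is integral then
    k^j divides a_j, so one listed coefficient 0 < a_j <= 30 with j > 0 leaves only k <= 30, and
    these are excluded by computing with the listed coefficients in binary. For the surfaces,
    minimality of the order of the Picard-Fuchs operator is preserved because a shift has an inverse
    shift. The delicate fibre is the one at infinity: there the shift sends s = 1/t to s / (lambda +
    alpha s), whose denominator is a unit at s = 0. *)

Definition series (F : Type) := nat -> F.

Section SeriesRing.
Variable F : numFieldType.
Local Notation S := (series F).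
Implicit Types a b c : S.

HB.instance Definition _ := gen_eqMixin S.
HB.instance Definition _ := gen_choiceMixin S.

Lemma seriesP a b : a =1 b -> a = b.
Proof. by move=> ab; apply: functional_extensionality_dep. Qed.

Definition sadd a b : S := fun n => a n + b n.
Definition sopp a : S := fun n => - a n.
Definition szero : S := fun=> 0.
Definition sone : S := fun n => (n == 0%N)%:R.
Definition smul a b : S := fun n => \sum_(i < n.+1) a i * b (n - i)%N.

Definition trunc N a : {poly F} := \poly_(i < N) a i.

Lemma coef_trunc N a n : (n < N)%N -> (trunc N a)`_n = a n.
Proof. by move=> nN; rewrite coef_poly nN. Qed.

(** A coefficient of a product involves finitely many coefficients of the factors, so commutativity
    and associativity can be inherited from [{poly F}]. *)
Lemma smul_trunc N a b n : (n < N)%N -> smul a b n = (trunc N a * trunc N b)`_n.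
Proof.
move=> nN; rewrite coefM; apply: eq_bigr => i _; rewrite !coef_trunc //.
  exact: leq_ltn_trans (leq_subr _ _) nN.
exact: leq_ltn_trans (leq_ord i) nN.
Qed.

Lemma saddA : associative sadd.
Proof. by move=> a b c; apply: seriesP => n; rewrite /sadd addrA. Qed.
Lemma saddC : commutative sadd.
Proof. by move=> a b; apply: seriesP => n; rewrite /sadd addrC. Qed.
Lemma sadd0 : left_id szero sadd.
Proof. by move=> a; apply: seriesP => n; rewrite /sadd add0r. Qed.
Lemma saddN : left_inverse szero sopp sadd.
Proof. by move=> a; apply: seriesP => n; rewrite /sadd addNr. Qed.

HB.instance Definition _ := GRing.isZmodule.Build S saddA saddC sadd0 saddN.

Lemma smulC : commutative smul.
Proof. by move=> a b; apply: seriesP => n; rewrite !(@smul_trunc n.+1) // mulrC. Qed.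

Lemma smulA : associative smul.
Proof.
move=> a b c; apply: seriesP => n.
transitivity ((trunc n.+1 a * (trunc n.+1 b * trunc n.+1 c))`_n).
  rewrite coefM; apply: eq_bigr => i _; rewrite coef_trunc ?ltn_ord //.
  by rewrite (@smul_trunc n.+1) // ltnS leq_subr.
rewrite mulrA coefM; apply: eq_bigr => i _.
rewrite (@smul_trunc n.+1) ?ltn_ord // coef_trunc //.
by rewrite ltnS leq_subr.
Qed.

Lemma smul1 : left_id sone smul.
Proof.
move=> a; apply: seriesP => n; rewrite /smul big_ord_recl /= mul1r subn0.
by rewrite big1 ?addr0 // => i _; rewrite /sone mul0r.
Qed.

Lemma smulDl : left_distributive smul sadd.
Proof.
move=> a b c; apply: seriesP => n; rewrite /smul /sadd -big_split /=.
by apply: eq_bigr => i _; rewrite mulrDl.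
Qed.

Lemma sone_neq0 : sone != 0 :> S.
Proof. by apply/eqP => /(congr1 (fun a => a 0%N)) /eqP; rewrite /sone oner_eq0. Qed.

HB.instance Definition _ :=
  GRing.Zmodule_isComNzRing.Build S smulA smulC smul1 smulDl sone_neq0.

Lemma coefsD a b n : (a + b : S) n = a n + b n. Proof. by []. Qed.
Lemma coefsN a n : (- a : S) n = - a n. Proof. by []. Qed.
Lemma coefsM a b n : (a * b : S) n = \sum_(i < n.+1) a i * b (n - i)%N.
Proof. by []. Qed.
Lemma coefs0 n : (0 : S) n = 0. Proof. by []. Qed.
Lemma coefs1 n : (1 : S) n = (n == 0%N)%:R. Proof. by []. Qed.
Lemma coefsMn a k n : (a *+ k : S) n = a n *+ k.
Proof. by elim: k => // k IHk; rewrite !mulrS coefsD IHk. Qed.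
Lemma coefs_sum (I : Type) (r : seq I) (f : I -> S) n :
  (\sum_(i <- r) f i) n = \sum_(i <- r) f i n.
Proof.
elim: r => [|x r IHr]; first by rewrite !big_nil.
by rewrite !big_cons coefsD IHr.
Qed.

Definition ser (p : {poly F}) : S := fun n => p`_n.

Fact ser_is_zmod_morphism : zmod_morphism ser.
Proof. by move=> p q; apply: seriesP => n; rewrite /ser coefB. Qed.
HB.instance Definition _ := GRing.isZmodMorphism.Build _ _ ser ser_is_zmod_morphism.

Fact ser_is_monoid_morphism : monoid_morphism ser.
Proof.
split; first by apply: seriesP => n; rewrite /ser coef1.
by move=> p q; apply: seriesP => n; rewrite /ser coefM.
Qed.
HB.instance Definition _ :=
  GRing.isMonoidMorphism.Build _ _ ser ser_is_monoid_morphism.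

Lemma coefsCM (x : F) a n : (ser x%:P * a) n = x * a n.
Proof.
rewrite coefsM big_ord_recl /ser coefC /= subn0 big1 ?addr0 // => i _.
by rewrite coefC mul0r.
Qed.

Lemma coefs0M a b : (a * b) 0%N = a 0%N * b 0%N.
Proof. by rewrite coefsM big_ord1. Qed.

Lemma coefsXM a n : (ser 'X * a) n = if n is m.+1 then a m else 0.
Proof.
case: n => [|n]; first by rewrite coefs0M /ser coefX mul0r.
rewrite coefsM !big_ord_recl /ser !coefX /= mul0r add0r mul1r big1 ?addr0.
  by rewrite subSS subn0.
by move=> i _; rewrite coefX mul0r.
Qed.

Definition sth a : S := fun n => n%:R * a n.

Lemma sthE a : sth a = ser 'X * (ser_deriv a : S).
Proof. by apply: seriesP => -[|n]; rewrite coefsXM /sth ?mul0r. Qed.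

Lemma sthD a b : sth (a + b) = sth a + sth b.
Proof. by apply: seriesP => n; rewrite /sth coefsD mulrDr. Qed.

Lemma sthN a : sth (- a) = - sth a.
Proof. by apply: seriesP => n; rewrite /sth coefsN mulrN. Qed.

Lemma sthM a b : sth (a * b) = sth a * b + a * sth b.
Proof.
apply: seriesP => n; rewrite /sth coefsD !coefsM mulr_sumr -big_split /=.
apply: eq_bigr => i _; rewrite -{1}(subnKC (leq_ord i)) natrD /sth.
by ring.
Qed.

Lemma ser_derivM a b : ser_deriv (a * b) = (ser_deriv a : S) * b
  + a * (ser_deriv b : S) :> S.
Proof.
apply: seriesP => n; have /(congr1 (fun c => c n.+1)) := sthM a b.
by rewrite !sthE mulrCA -mulrA -mulrDr !coefsXM.
Qed.

Lemma sth_ser p : sth (ser p) = ser ('X * p^`()).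
Proof.
apply: seriesP => -[|n]; first by rewrite /sth mul0r /ser coefXM.
by rewrite /sth /ser coefXM coef_deriv mulr_natl.
Qed.

Lemma ser_deriv_ser p : ser_deriv (ser p) = ser p^`().
Proof. by apply: seriesP => n; rewrite /ser_deriv /ser coef_deriv mulr_natl. Qed.

Lemma sth_nat k : sth k%:R = 0.
Proof.
apply: seriesP => n; rewrite /sth coefsMn coefs1.
by case: n => [|n]; rewrite ?mul0r // mul0rn mulr0.
Qed.

Lemma sth_natM k a : sth (k%:R * a) = k%:R * sth a.
Proof. by rewrite sthM sth_nat mul0r add0r. Qed.

Lemma sthX a n : sth (a ^+ n.+1) = n.+1%:R * a ^+ n * sth a.
Proof.
elim: n => [|n IHn]; first by rewrite mul1r expr0 mul1r.
by rewrite exprS sthM IHn [in RHS]mulrS exprS; ring.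
Qed.

Lemma series_natI k a : k.+1%:R * a = 0 -> a = 0.
Proof.
move=> ka; apply: seriesP => n; have := congr1 (fun c => c n) ka.
rewrite mulr_natl coefsMn coefs0 => /eqP.
by rewrite -mulr_natl mulf_eq0 pnatr_eq0 /= => /eqP.
Qed.

(** * Congruence modulo powers of t, and series with integer coefficients *)

Definition eqmod N a b := forall i, (i < N)%N -> a i = b i.

Lemma eqmod_refl N a : eqmod N a a. Proof. by []. Qed.
Lemma eqmodD N a b a' b' : eqmod N a a' -> eqmod N b b' -> eqmod N (a + b) (a' + b').
Proof. by move=> aa bb i iN; rewrite !coefsD aa ?bb. Qed.
Lemma eqmodN N a a' : eqmod N a a' -> eqmod N (- a) (- a').
Proof. by move=> aa i iN; rewrite !coefsN aa. Qed.
Lemma eqmodM N a b a' b' : eqmod N a a' -> eqmod N b b' -> eqmod N (a * b) (a' * b').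
Proof.
move=> aa bb i iN; rewrite !coefsM; apply: eq_bigr => j _.
rewrite aa ?bb //; first exact: leq_ltn_trans (leq_subr _ _) iN.
exact: leq_ltn_trans (leq_ord j) iN.
Qed.
Lemma eqmodXn N k a a' : eqmod N a a' -> eqmod N (a ^+ k) (a' ^+ k).
Proof. by move=> aa; elim: k => [|k IHk]; rewrite ?expr0 // !exprS; apply: eqmodM. Qed.
Lemma eqmod_sth N a a' : eqmod N a a' -> eqmod N (sth a) (sth a').
Proof. by move=> aa i iN; rewrite /sth aa. Qed.
Lemma eqmodS_XM N a b : eqmod N a b -> eqmod N.+1 (ser 'X * a) (ser 'X * b).
Proof. by move=> ab [|i] iN; rewrite !coefsXM // ab. Qed.

(** A series with non-zero constant term can be cancelled modulo t^N: the lowest non-zero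
    coefficient of [b] would survive in the product. *)
Lemma eqmod0M N a b : a 0%N != 0 -> eqmod N (a * b) 0 -> eqmod N b 0.
Proof.
move=> a0 ab n; elim/ltn_ind: n => n IHn nN.
have := ab n nN; rewrite coefsM big_ord_recl subn0 big1 ?addr0 => [/eqP|i _].
  by rewrite mulf_eq0 (negPf a0) => /eqP.
rewrite IHn ?mulr0 //= /bump /= add1n;
  first by rewrite ltn_subrL (leq_ltn_trans _ (ltn_ord i)).
by apply: leq_ltn_trans nN; rewrite leq_subr.
Qed.

Lemma eqmod_exp N a : a 0%N = 0 -> eqmod N (a ^+ N) 0.
Proof.
move=> a0; elim: N => [//|N IHN] n nN; rewrite exprS coefsM big1 // => i _.
case: i => -[|i] /= iN; first by rewrite a0 mul0r.
rewrite IHN ?mulr0 //; lia.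
Qed.

Lemma integral_seriesn k : integral (k%:R : S).
Proof.
move=> n; rewrite coefsMn coefs1; exists ((n == 0%N)%:Z *+ k).
by rewrite rmorphMn /=; case: eqP.
Qed.
Lemma integralD a b : integral a -> integral b -> integral (a + b).
Proof. by move=> az bz n; have [[x ax] [y yb]] := (az n, bz n); exists (x + y);
  rewrite coefsD ax yb rmorphD. Qed.
Lemma integralN a : integral a -> integral (- a).
Proof. by move=> az n; have [x ax] := az n; exists (- x);
  rewrite coefsN ax rmorphN. Qed.
Lemma integralM a b : integral a -> integral b -> integral (a * b).
Proof.
move=> az bz n; rewrite coefsM.
apply: (big_ind (fun x : F => exists z : int, x = z%:~R)) => [|x y [i ->] [j ->]|i _].
- by exists 0.
- by exists (i + j); rewrite rmorphD.
have [[x ->] [y ->]] := (az i, bz (n - i)%N).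
by exists (x * y); rewrite rmorphM.
Qed.
Lemma integralX a k : integral a -> integral (a ^+ k).
Proof.
by move=> az; elim: k => [|k IHk]; rewrite ?exprS;
  [apply: (integral_seriesn 1)|apply: integralM].
Qed.

(* The limit of the iterates of a contraction for the t-adic topology. *)
Lemma series_fixpoint (Phi : S -> S) :
    (forall N a b, eqmod N a b -> eqmod N.+1 (Phi a) (Phi b)) ->
    (forall a, integral a -> integral (Phi a)) ->
  exists2 a, a = Phi a & integral a.
Proof.
move=> contr int; pose it k := iter k Phi 0.
have itE k l : eqmod k (it k) (it (k + l)%N).
  by elim: k => // k IHk; rewrite addSn; apply: contr.
pose a : S := fun n => it n.+1 n.
have aE N : eqmod N a (it N).
  by move=> i iN; rewrite /a (itE i.+1 (N - i.+1)%N) // subnKC.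
exists a => [|n].
  apply: seriesP => n; rewrite (aE n.+1) //=; apply: esym.
  exact: (contr n) (aE n) _ _.
rewrite /a; suff: integral (it n.+1) by [].
by elim: n.+1 => [|k IHk]; [apply: (integral_seriesn 0)|apply: int].
Qed.

(* The root is sought in the form [u = 1 + 2 t w]. *)
Lemma fourth_root_inverse (x : S) : integral x ->
  exists u : S, [/\ u ^+ 4 * (1 + 8%:R * (ser 'X * x)) = 1, u 0%N = 1 & integral u].
Proof.
move=> xz; set X := ser 'X.
(* Expanding the fourth power, u^4 (1 + 8 t x) - 1 equals 8 t (w - Phi w). Each w in [Phi] is
   accompanied by a factor t, so [Phi] is a contraction. *)
pose Phi (w : S) : S := - (X * (3%:R * w ^+ 2 + 4%:R * (X * w ^+ 3)
  + 2%:R * (X ^+ 2 * w ^+ 4))) - x * (1 + 2%:R * (X * w)) ^+ 4.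
have [||w wE wz] := @series_fixpoint Phi.
- move=> N a b ab; apply: eqmodD.
    apply: eqmodN; apply: eqmodS_XM.
    by do !apply: eqmodD; do ?[apply: eqmodM => //|apply: eqmodXn].
  apply: eqmodN; apply: eqmodM => //; apply: eqmodXn; apply: eqmodD => //.
  by apply: eqmodM => //; apply: eqmodS_XM.
- have Xz : integral X.
    by move=> n; rewrite /X /ser coefX; exists (n == 1%N)%:Z; case: eqP.
  move=> w wz; rewrite /Phi.
  by do !first [exact: (integral_seriesn 1) | exact: integral_seriesn | assumption
    | apply: integralD | apply: integralN | apply: integralM | apply: integralX].
exists (1 + 2%:R * (X * w)); split.
- have -> : (1 + 2%:R * (X * w)) ^+ 4 * (1 + 8%:R * (X * x)) = 1
  + 8%:R * X * (w - Phi w).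
    by rewrite /Phi; move: X w {wE wz Phi} => X w; ring.
  by rewrite -wE subrr mulr0 addr0.
- by rewrite coefsD coefs1 mulr_natl coefsMn coefsXM mul0rn addr0.
apply: integralD; first exact: (integral_seriesn 1).
apply: integralM; first exact: integral_seriesn.
move=> [|n]; rewrite coefsXM; last exact: wz.
by exists 0.
Qed.

(** * Telescoping sums for hypergeometric pull-backs *)

Section Telescope.
(* The hypotheses express that [u f(z)] is a solution of theta P theta + q whenever
   f is one of the hypergeometric operator theta^2 - z (k1 theta^2 + k2 theta + k3). *)
Variables (P q u z K R : S) (k1 k2 k3 : nat).
Hypotheses (h1 : P * sth z = K * z)
  (h2 : P * sth (u * K) + K * (P * sth u) = - (k2%:R * R * u * z))
  (h3 : P * sth (P * sth u) + P * (q * u) = - (k3%:R * R * u * z))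
  (h4 : K ^+ 2 = R * (1 - k1%:R * z)).

Definition pf_op (a : S) : S := sth (P * sth a) + q * a.

(** By [h1], P theta acts on functions of z as K times z d/dz. In P (theta P theta + q)(u f(z)) the
    coefficients of the three z-derivatives of f are the left sides of [h3], [h2] and u times that
    of [h4]. *)
Lemma pf_op_pullback n : P * pf_op (u * z ^+ n) =
  R * u * (n%:R ^+ 2 * z ^+ n - (k1%:R * n%:R ^+ 2 + k2%:R * n%:R + k3%:R) * z ^+ n.+1).
Proof.
have Pzn : P * sth (z ^+ n) = n%:R * K * z ^+ n.
  case: n => [|n]; first by rewrite (sth_nat 1) mulr0 !mul0r.
  by rewrite sthX mulrCA h1 [in RHS]exprS; ring.
have Puz : P * sth (u * z ^+ n) = (P * sth u + n%:R * (u * K)) * z ^+ n.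
  by rewrite sthM mulrDr [P * (u * _)]mulrCA Pzn; ring.
rewrite /pf_op Puz [sth (_ * z ^+ n)]sthM sthD sth_natM !mulrDr.
rewrite [P * (_ * sth (z ^+ n))]mulrCA Pzn [z ^+ n.+1]exprS.
transitivity ((P * sth (P * sth u) + P * (q * u)
  + n%:R * (P * sth (u * K) + K * (P * sth u)) + n%:R ^+ 2 * u * K ^+ 2) * z ^+ n);
  first by ring.
rewrite h2 h3 h4; move: (z ^+ n) => zn; ring.
Qed.

Variable c : nat -> nat.
Hypothesis cE : forall n, (c n.+1 * n.+1 ^ 2 = (k1 * n ^ 2 + k2 * n + k3) * c n)%N.

Definition pf_sum N : S := \sum_(n < N) (c n)%:R * (u * z ^+ n).

Lemma pf_opD a b : pf_op (a + b) = pf_op a + pf_op b.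
Proof. by rewrite /pf_op sthD !mulrDr sthD; ring. Qed.

Lemma pf_op_natM k a : pf_op (k%:R * a) = k%:R * pf_op a.
Proof. by rewrite /pf_op sth_natM mulrCA sth_natM; ring. Qed.

(** The recurrence [cE] cancels the z^(n+1) part of the n-th term against the z^(n+1) part of the
    next one, leaving only the top term. *)
Lemma pf_op_sum N : P * pf_op (pf_sum N) = - (R * u * (c N * N ^ 2)%:R * z ^+ N).
Proof.
elim: N => [|N IHN].
  rewrite /pf_sum big_ord0 muln0 mulr0 mul0r oppr0 /pf_op.
  by rewrite !(sth_nat 0, mulr0, addr0).
rewrite /pf_sum big_ord_recr /= -/(pf_sum N) pf_opD pf_op_natM mulrDr IHN.
rewrite [P * (_ * _)]mulrCA pf_op_pullback cE !(natrD, natrM, natrX).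
by ring.
Qed.

(** The infinite sum: when z has no constant term, z^i starts in degree at least i, so coefficient n
    is already that of the partial sum with n + 1 terms. *)
Definition pf_series : S := fun n => pf_sum n.+1 n.

Hypotheses (z0 : z 0%N = 0) (P0 : P 0%N != 0).

Lemma pf_series_eqmod N : eqmod N pf_series (pf_sum N).
Proof.
move=> n nN; rewrite /pf_series /pf_sum -!(big_mkord xpredT (fun n =>
  (c n)%:R * (u * z ^+ n))).
rewrite (@big_cat_nat _ _ _ n.+1 0 N) //= coefsD.
rewrite [X in _ = _ + X](_ : _ = 0) ?addr0 //.
rewrite coefs_sum big_nat_cond big1 // => i /andP[/andP[ni _] _].
rewrite mulr_natl coefsMn.
suff -> : (u * z ^+ i) n = 0 by rewrite mul0rn.
have /eqmodM/(_ (@eqmod_exp i _ z0)) := @eqmod_refl i u.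
by move/(_ n ni); rewrite mulr0.
Qed.

Lemma pf_op_pf_series : pf_op pf_series = 0.
Proof.
apply: seriesP => n.
have sE : eqmod n.+1 (pf_op pf_series) (pf_op (pf_sum n.+1)).
  have e := @pf_series_eqmod n.+1.
  rewrite /pf_op; apply: eqmodD; last exact: eqmodM.
  by apply: eqmod_sth; apply: eqmodM => //; apply: eqmod_sth.
(* P is invertible as a power series, and the remainder left by the telescoping contains z^(n+1),
   which vanishes modulo t^(n+1). *)
rewrite sE //; apply: (@eqmod0M n.+1 P) => // i iN.
rewrite pf_op_sum coefsN.
have /eqmodM/(_ (@eqmod_exp n.+1 _ z0))/(_ i iN) ->
  := @eqmod_refl n.+1 (R * u * (c n.+1 * n.+1 ^ 2)%:R).
by rewrite mulr0 oppr0.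
Qed.

Lemma pf_series_integral : integral u -> integral z -> integral pf_series.
Proof.
move=> uz zz n; suff pz : integral (pf_sum n.+1) by exact: pz.
rewrite /pf_sum; apply: (big_ind (fun a : S => integral a)) => [|a b|i _].
- exact: (integral_seriesn 0).
- exact: integralD.
by apply: integralM; [apply: integral_seriesn|apply: integralM => //; apply: integralX].
Qed.

Lemma pf_series0 : c 0%N = 1%N -> u 0%N = 1 -> pf_series 0%N = 1.
Proof. by move=> c0 u0; rewrite /pf_series /pf_sum big_ord1 c0 mul1r expr0 mulr1. Qed.
End Telescope.
End SeriesRing.

(** * Integral hypergeometric coefficients *)

Section HypergeometricCoefficients.
Local Open Scope nat_scope.

(** The instances below are 3 (3n+1)(3n+2) = 27 n^2 + 27 n + 6, 4 (4n+1)(4n+3) = 64 n^2 + 64 n + 12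
    and 12 (12n+1)(12n+5) = 1728 n^2 + 864 n + 60. *)
Definition hypergeometric_rec (k1 k2 k3 : nat) (c : nat -> nat) :=
  c 0 = 1 /\ forall n, c n.+1 * n.+1 ^ 2 = (k1 * n ^ 2 + k2 * n + k3) * c n.

Lemma hypergeometric3 : exists c, hypergeometric_rec 27 27 6 c.
Proof.
pose c n := 'C(3 * n, n) * 'C(2 * n, n); exists c; split=> // n.
have cE m : c m * m`! ^ 3 = (3 * m)`!.
  have e1 := @bin_fact (3 * m) m ltac:(lia).
  have e2 := @bin_fact (2 * m) m ltac:(lia).
  rewrite (_ : 3 * m - m = 2 * m) in e1; last lia.
  rewrite (_ : 2 * m - m = m) in e2; last lia.
  by rewrite -e1 -e2 /c; ring.
have f3 : (3 * n.+1)`! = 3 * n.+1 * (3 * n + 2) * (3 * n + 1) * (3 * n)`!.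
  by rewrite (_ : 3 * n.+1 = (3 * n).+3) ?factS; nia.
have f0 : 0 < n.+1 * n`! ^ 3 by rewrite muln_gt0 expn_gt0 fact_gt0.
apply/eqP; rewrite -(eqn_pmul2r f0); apply/eqP.
have := cE n.+1; rewrite f3 -cE factS => e.
transitivity (c n.+1 * (n.+1 * n`!) ^ 3); first by ring.
by rewrite e; ring.
Qed.

Lemma hypergeometric4 : exists c, hypergeometric_rec 64 64 12 c.
Proof.
pose c n := 'C(4 * n, 2 * n) * 'C(2 * n, n); exists c; split=> // n.
have cE m : c m * (m`! ^ 2 * (2 * m)`!) = (4 * m)`!.
  have e1 := @bin_fact (4 * m) (2 * m) ltac:(lia).
  have e2 := @bin_fact (2 * m) m ltac:(lia).
  rewrite (_ : 4 * m - 2 * m = 2 * m) in e1; last lia.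
  rewrite (_ : 2 * m - m = m) in e2; last lia.
  by rewrite -e1 -{3}e2 /c; ring.
have f4 : (4 * n.+1)`! = 4 * n.+1 * (4 * n + 3) * (4 * n + 2) * (4 * n + 1) * (4 * n)`!.
  by rewrite (_ : 4 * n.+1 = (4 * n).+4) ?factS; nia.
have f2 : (2 * n.+1)`! = 2 * n.+1 * (2 * n + 1) * (2 * n)`!.
  by rewrite (_ : 2 * n.+1 = (2 * n).+2) ?factS; nia.
have f0 : 0 < n.+1 * (2 * n + 1) * 2 * (n`! ^ 2 * (2 * n)`!).
  by rewrite !muln_gt0 !fact_gt0 addn1.
apply/eqP; rewrite -(eqn_pmul2r f0); apply/eqP.
have := cE n.+1; rewrite f4 f2 -cE factS => e.
transitivity (c n.+1 * ((n.+1 * n`!) ^ 2 * (2 * n.+1 * (2 * n + 1) * (2 * n)`!))).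
  by ring.
by rewrite e; ring.
Qed.

(** Legendre's formula, where p * (n %/ p^(k+1)) <= n %/ p^k makes the sum telescope; the last
    quotient is kept in the claim so that the induction closes. *)
Lemma logn_fact_le p n : 0 < p -> p.-1 * logn p n`! <= n.
Proof.
case: p => // p _; case: (boolP (prime p.+1)) => [pP|/negPf npP]; last first.
  by rewrite lognE npP /= muln0.
rewrite logn_fact //=.
suff le K : p * (\sum_(1 <= k < K.+1) n %/ p.+1 ^ k) + n %/ p.+1 ^ K <= n.
  exact: leq_trans (leq_addr _ _) (le n).
elim: K => [|K IHK]; first by rewrite big_geq // muln0 expn0 divn1.
rewrite big_nat_recr //= mulnDr -addnA; apply: leq_trans IHK.
rewrite leq_add2l expnSr divnMA -[X in _ + X]mul1n -mulnDl addn1 mulnC.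
exact: leq_trunc_div.
Qed.

(** Modulo d the step m is invertible, so a = m e and the product becomes m^n times n consecutive
    integers, which n! divides. *)
Lemma dvdn_prod_progression d m a n : coprime d m -> d %| n`! ->
  d %| \prod_(k < n) (m * k + a).
Proof.
case: d => [|d] co dn.
  by move: (fact_gt0 n) dn; rewrite dvd0n lt0n => /negPf ->.
have [e eE] : exists e, m * e = a %[mod d.+1].
  exists (chinese d.+1 m a 0 %/ m).
  have /dvdnP[e eE] : m %| chinese d.+1 m a 0.
    by rewrite /dvdn chinese_modr // mod0n.
  case: (posnP m) => [m0|m0]; last by rewrite eE mulnK // mulnC -eE chinese_modl.
  by move: co; rewrite m0 /coprime gcdn0 => /eqP ->; rewrite !modn1.
have prodE : \prod_(k < n) (m * k + a) = m ^ n * \prod_(k < n) (k + e) %[mod d.+1].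
  elim: n {dn} => [|n IHn]; first by rewrite !big_ord0.
  rewrite !big_ord_recr /= expnSr -modnMml IHn modnMml -modnMmr -modnDmr -eE.
  by rewrite modnDmr modnMmr; congr (_ %% _); ring.
rewrite /dvdn prodE -/(dvdn _ _) dvdn_mull //.
apply: dvdn_trans dn _.
have -> : \prod_(k < n) (k + e) = (e + n).-1 ^_ n.
  elim: n {prodE} => [|n IHn]; first by rewrite big_ord0.
  rewrite big_ord_recr /= IHn addnS /=.
  case: e {eE IHn} => [|e]; last by rewrite addSn ffactSS mulnC addnS [(n + e)%N]addnC.
  case: n => [|n]; first by rewrite muln0 ffactn1.
  by rewrite !add0n /= !ffact_small.
by rewrite -bin_ffact dvdn_mull.
Qed.

(** Divisibility by n!^2 is checked prime by prime. The factor 12^n = 4^n 3^n pays for 2 and 3,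
    since v_2(n!) <= n and 2 v_3(n!) <= n; for p >= 5 each progression contains the p-part of n!. *)
Lemma hypergeometric6 : exists c, hypergeometric_rec 1728 864 60 c.
Proof.
pose N n := 12 ^ n * (\prod_(k < n) (12 * k + 1) * \prod_(k < n) (12 * k + 5)).
have Ndvd n : n`! ^ 2 %| N n.
  have f0 : 0 < n`! ^ 2 by rewrite expn_gt0 fact_gt0.
  apply/(dvdn_partP _ f0) => p; rewrite mem_primes => /andP[pP _].
  rewrite p_part lognX.
  have le := logn_fact_le n (prime_gt0 pP).
  case: (altP (p =P 2)) => [p2|p2].
    apply: dvdn_mulr; rewrite p2 in le *.
    apply: (@dvdn_trans (2 ^ (2 * n))); first by apply: dvdn_exp2l; lia.
    by rewrite expnM (dvdn_exp2r (m := 4)).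
  case: (altP (p =P 3)) => [p3|p3].
    apply: dvdn_mulr; rewrite p3 in le *.
    apply: (@dvdn_trans (3 ^ n)); first by apply: dvdn_exp2l; lia.
    by rewrite (dvdn_exp2r (m := 3)).
  apply: dvdn_mull; rewrite mul2n -addnn expnD.
  have co : coprime (p ^ logn p n`!) 12.
    apply: coprimeXl; rewrite prime_coprime //; apply/negP.
    rewrite (_ : 12 = 2 * 2 * 3) // !Euclid_dvdM // !dvdn_prime2 //.
    by rewrite (negPf p2) (negPf p3).
  by apply: dvdn_mul; apply: dvdn_prod_progression => //; rewrite pfactor_dvdnn.
pose c n := N n %/ n`! ^ 2.
have cE m : c m * m`! ^ 2 = N m by rewrite divnK.
exists c; split=> [|n]; first by rewrite /c /N !big_ord0.
have f0 : 0 < n`! ^ 2 by rewrite expn_gt0 fact_gt0.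
apply/eqP; rewrite -(eqn_pmul2r f0); apply/eqP.
have := cE n.+1; rewrite /N !big_ord_recr /= factS => e.
transitivity (c n.+1 * (n.+1 * n`!) ^ 2); first by ring.
by rewrite e -[RHS]mulnA cE /N expnS; ring.
Qed.
End HypergeometricCoefficients.

(** * Pull-backs *)

Section Pullback.
Variable F : numFieldType.
Local Notation S := (series F).
Local Notation "''th' p" := ('X * p^`()) (at level 10).
Implicit Types (P q A B G H W x : {poly F}) (h : F).

Definition integral_solution P q := exists phi : S,
  [/\ pf_op (ser P) (ser q) phi = 0, phi 0%N = 1 & integral phi].

Lemma ser_eq p1 p2 : p1 = p2 :> {poly F} -> ser p1 = ser p2. Proof. by move->. Qed.

Lemma integral_serX : @integral F (ser 'X).
Proof. by move=> n; rewrite /ser coefX; exists (n == 1%N)%:Z; case: eqP. Qed.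

(** A^2 = 1 + 8 t (x + 2 t x^2) has an inverse fourth root u. Then (u^2 A + 1)(u^2 A - 1) = 0, and
    the first factor has constant term 2, hence can be cancelled. *)
Lemma inverse_sqrt A x : A = 1 + 4%:R * 'X * x -> integral (ser x) ->
  exists u : S, [/\ u ^+ 2 * ser A = 1, u 0%N = 1 & integral u].
Proof.
move=> AE xz.
have [|u [u4 u0 uz]] := @fourth_root_inverse F (ser (x + 2%:R * 'X * x ^+ 2)).
  rewrite rmorphD !rmorphM rmorph_nat /=; apply: integralD => //.
  by do !apply: integralM => //; [exact: integral_seriesn|exact: integral_serX].
exists u; split=> //.
have {}u4 : u ^+ 4 * ser A ^+ 2 = 1.
  rewrite -[RHS]u4 AE !(rmorph_nat, rmorphXn, rmorphD, rmorphM, rmorph1) /=.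
  by move: (ser 'X) (ser x) => X y; ring.
apply/eqP; rewrite -subr_eq0; apply/eqP; apply: seriesP => n.
have A0 : ser A 0%N = 1.
  by rewrite AE /ser coefD coef1 -mulrA mulr_natl coefMn coefXM mul0rn addr0.
apply: (@eqmod0M _ n.+1 (u ^+ 2 * ser A + 1)) => [|i _|//].
  by rewrite coefsD coefs0M expr2 coefs0M u0 A0 !mulr1 (_ : _ + _ = 2%:R) ?pnatr_eq0.
suff -> : (u ^+ 2 * ser A + 1) * (u ^+ 2 * ser A - 1) = 0 by [].
transitivity (u ^+ 4 * ser A ^+ 2 - 1); last by rewrite u4 subrr.
by move: (ser A) => a; ring.
Qed.

(* The solution A^(-1/2) \sum_n c_n (B / A^2)^n, with W / A^2 = 1 - k B / A^2. *)
Lemma integral_solution_sqrt P q A B W A' B' A2 x (h k k3 : nat) c :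
    hypergeometric_rec k k k3 c ->
    integral (ser x) -> integral (ser B) -> B`_0 = 0 -> P`_0 != 0 ->
    A' = 'th A -> B' = 'th B -> A2 = 'th (P * A') ->
    A = 1 + 4%:R * 'X * x ->
    W = A ^+ 2 - k%:R * B ->
    P * (B' * A - 2%:R * B * A') = h%:R * W * B ->
    4%:R * P * q * A ^+ 2 + 3%:R * P ^+ 2 * A' ^+ 2 - 2%:R * P * A2 * A
      = - (4%:R * k3%:R * h%:R ^+ 2 * W * B) ->
  integral_solution P q.
Proof.
move=> [c0 cE] xz Bz B0 P0 A'E B'E A2E AE WE /ser_eq eB /ser_eq eA.
have [u [uA u0 uz]] := inverse_sqrt AE xz.
have thA : sth (ser A) = ser A' by rewrite sth_ser A'E.
have thB : sth (ser B) = ser B' by rewrite sth_ser B'E.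
have thPA : sth (ser P * ser A') = ser A2 by rewrite -rmorphM sth_ser A2E.
have thW : sth (ser W) = 2%:R * ser A * ser A' - k%:R * ser B'.
  rewrite WE rmorphB rmorphXn rmorphM rmorph_nat sthD sthX thA /=.
  by rewrite sthN sth_natM thB expr1.
have thu : 2%:R * sth u = - (u ^+ 3 * ser A').
  have := congr1 (fun a => u * sth a) uA.
  rewrite (sth_nat _ 1) mulr0 sthM sthX thA => e.
  transitivity (2%:R * (u ^+ 2 * ser A) * sth u); first by rewrite uA mulr1.
  by apply/eqP; rewrite -subr_eq0 opprK -e; apply/eqP; move: (ser A) => a; ring.
have [z0 P0'] : (ser B * u ^+ 4) 0%N = 0 /\ ser P 0%N != 0.
  by split=> //; rewrite coefs0M /ser B0 mul0r.
have WE' := ser_eq WE.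
rewrite !(rmorph_nat, rmorphXn, rmorphB, rmorphD, rmorphN, rmorphM) /= in eB eA WE'.
have thh : sth (h%:R : S) = 0 := sth_nat F h.
(* As u^2 = 1/A, these are z = B/A^2, K = h W/A and R = h^2 W, so that K^2 = R (W/A^2) = R (1 - k
   z). *)
pose z : S := ser B * u ^+ 4; pose K : S := h%:R * ser W * u ^+ 2.
pose R : S := h%:R ^+ 2 * ser W.
have [h1 h2 h3 h4] : [/\ ser P * sth z = K * z,
   ser P * sth (u * K) + K * (ser P * sth u) = - (k%:R * R * u * z),
   ser P * sth (ser P * sth u) + ser P * (ser q * u) = - (k3%:R * R * u * z) &
   K ^+ 2 = R * (1 - k%:R * z)].
  rewrite {}/z {}/K {}/R; clear z0 P0' WE AE A2E A'E B'E P0 B0 Bz xz uz u0 cE c0.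
  set Z := ser q in eA *; clearbody Z.
  (* What remains are identities in a commutative ring. Each is written as an explicit combination
     of the polynomial hypotheses, of u^2 A = 1 and of 2 theta u = - u^3 theta A; [series_natI]
     removes the denominators. *)
  move: (ser P) (h%:R : S) (ser A) (ser B) (ser W) (ser A') (ser B') (ser A2) thA thB
    thPA thW thu uA eB eA WE' thh =>
    p h' a b w a' b' a2 thA thB thPA thW thu uA eB eA WE thh.
  split.
  - rewrite sthM sthX thB.
    transitivity (u ^+ 6 * (p * (b' * a - 2%:R * b * a'))
      + p * b' * u ^+ 4 * (1 - u ^+ 2 * a)
      + 2%:R * p * b * u ^+ 3 * (2%:R * sth u + u ^+ 3 * a')); first by ring.
    by rewrite eB uA thu; ring.
  - apply/eqP; rewrite -subr_eq0; apply/eqP; apply: (@series_natI _ 1).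
    rewrite !sthM thh thW.
    transitivity (2%:R * h' * u ^+ 5 * (p * (2%:R * a * a' - k%:R * b')* a
      + k%:R * h' * w * b)
      + 2%:R * h' * p * (2%:R * a * a' - k%:R * b') * u ^+ 3 * (1 - u ^+ 2 * a)
      - 4%:R * h' * p * w * a' * u ^+ 5
      + 4%:R * h' * p * w * u ^+ 2 * (2%:R * sth u + u ^+ 3 * a')).
      by ring.
    rewrite uA thu subrr addNr !mulr0 !addr0.
    transitivity (- 2%:R * k%:R * h' * u ^+ 5 * (p * (b' * a - 2%:R * b * a')
      - h' * w * b) + 4%:R * h' * p * a' * u ^+ 5 * (a ^+ 2 - k%:R * b - w));
      first by ring.
    by rewrite eB WE !subrr !mulr0 addr0.
  (* The last polynomial hypothesis is this identity multiplied by 4 u^(-5). *)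
  - have Pthu : 2%:R * (p * sth u) = - (p * a' * u ^+ 3) by rewrite mulrCA thu; ring.
    have thPthu : 2%:R * sth (p * sth u) =
      - (a2 * u ^+ 3 + p * a' * (3%:R * u ^+ 2 * sth u)).
      by rewrite -sth_natM Pthu sthN sthM thPA sthX.
    apply/eqP; rewrite -subr_eq0; apply/eqP; apply: (@series_natI _ 3).
    transitivity (2%:R * p * (2%:R * sth (p * sth u)) + 4%:R * p * Z * u
      + 4%:R * (k3%:R * (h' ^+ 2 * w) * u * (b * u ^+ 4))).
      by ring.
    rewrite thPthu.
    transitivity (u ^+ 5 * (4%:R * p * Z * a ^+ 2 + 3%:R * p ^+ 2 * a' ^+ 2
      - 2%:R * p * a2 * a + 4%:R * k3%:R * h' ^+ 2 * w * b)
      - 3%:R * p ^+ 2 * a' * u ^+ 2 * (2%:R * sth u + u ^+ 3 * a')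
      - (2%:R * p * a2 * u ^+ 3) * (1 - u ^+ 2 * a)
        + 4%:R * p * Z * u * (1 - (u ^+ 2 * a) ^+ 2)); first by ring.
    by rewrite eA uA thu; ring.
  - transitivity (h' ^+ 2 * w * (w * u ^+ 4)); first by ring.
    rewrite {2}WE; transitivity (h' ^+ 2 * w * ((u ^+ 2 * a) ^+ 2
      - k%:R * (b * u ^+ 4))); first by ring.
    by rewrite uA; ring.
have cE' : forall n, (c n.+1 * n.+1 ^ 2 = (k * n ^ 2 + k * n + k3) * c n)%N by [].
exists (pf_series u z c); split.
- exact: (pf_op_pf_series h1 h2 h3 h4 cE' z0 P0').
- exact: pf_series0.
- apply: pf_series_integral => //; apply: integralM => //; exact: integralX.
Qed.

(* The solution G^(-1/4) \sum_n c_n (B / G^3)^n, with B / G^3 = 1 / j. *)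
Lemma integral_solution_fourth_root P q G B H G' B' H' G2 x (h : nat) c :
    hypergeometric_rec 1728 864 60 c ->
    integral (ser x) -> integral (ser B) -> B`_0 = 0 -> P`_0 != 0 ->
    G' = 'th G -> B' = 'th B -> H' = 'th H -> G2 = 'th (P * G') ->
    G = 1 + 8%:R * 'X * x ->
    G ^+ 3 - H ^+ 2 = 1728%:R * B ->
    P * (B' * G - 3%:R * B * G') = h%:R * H * B ->
    P * (2%:R * H' * G - 3%:R * H * G') = - (h%:R * 1728%:R * B) ->
    5%:R * P ^+ 2 * G' ^+ 2 + 16%:R * P * q * G ^+ 2 - 4%:R * P * G2 * G
      = - (960%:R * h%:R ^+ 2 * B) ->
  integral_solution P q.
Proof.
move=> [c0 cE] xz Bz B0 P0 G'E B'E H'E G2E GE /ser_eq BE /ser_eq eB /ser_eq eH /ser_eq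
  eG.
have [|u [uG u0 uz]] := @fourth_root_inverse F (ser x) => //.
have {}uG : u ^+ 4 * ser G = 1.
  by rewrite -[RHS]uG GE !(rmorph_nat, rmorphD, rmorphM, rmorph1) /= mulrA.
have thG : sth (ser G) = ser G' by rewrite sth_ser G'E.
have thB : sth (ser B) = ser B' by rewrite sth_ser B'E.
have thH : sth (ser H) = ser H' by rewrite sth_ser H'E.
have thPG : sth (ser P * ser G') = ser G2 by rewrite -rmorphM sth_ser G2E.
have thu : 4%:R * sth u = - (u ^+ 5 * ser G').
  have := congr1 (fun a => u * sth a) uG.
  rewrite (sth_nat _ 1) mulr0 sthM sthX thG => e.
  transitivity (4%:R * (u ^+ 4 * ser G) * sth u); first by rewrite uG mulr1.
  by apply/eqP; rewrite -subr_eq0 opprK -e; apply/eqP; move: (ser G) => a; ring.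
have [z0 P0'] : (ser B * u ^+ 12) 0%N = 0 /\ ser P 0%N != 0.
  by split=> //; rewrite coefs0M /ser B0 mul0r.
rewrite !(rmorph_nat, rmorphXn, rmorphB, rmorphD, rmorphN, rmorphM) /= in eB eG eH BE.
have thh : sth (h%:R : S) = 0 := sth_nat F h.
(* As u^4 = 1/G, these are z = B/G^3, K = h H/G and R = h^2 G; then G^3 - H^2 = 1728 B is the
   relation K^2 = R (1 - 1728 z). *)
pose z : S := ser B * u ^+ 12; pose K : S := h%:R * ser H * u ^+ 4.
pose R : S := h%:R ^+ 2 * ser G.
have [h1 h2 h3 h4] : [/\ ser P * sth z = K * z,
   ser P * sth (u * K) + K * (ser P * sth u) = - (864%:R * R * u * z),
   ser P * sth (ser P * sth u) + ser P * (ser q * u) = - (60%:R * R * u * z) &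
   K ^+ 2 = R * (1 - 1728%:R * z)].
  rewrite {}/z {}/K {}/R; clear z0 P0' GE G2E G'E B'E H'E P0 B0 Bz xz uz u0 cE c0.
  set Z := ser q in eG *; clearbody Z.
  move: (ser P) (h%:R : S) (ser G) (ser B) (ser H) (ser G') (ser B') (ser H') (ser G2)
    thG thB thPG thH thu uG eB eG eH BE thh =>
    p h' g b w g' b' w' g2 thG thB thPG thH thu uG eB eG eH BE thh.
  split.
  - rewrite sthM sthX thB.
    transitivity (u ^+ 16 * (p * (b' * g - 3%:R * b * g'))
      + p * b' * u ^+ 12 * (1 - u ^+ 4 * g)
      + 3%:R * p * b * u ^+ 11 * (4%:R * sth u + u ^+ 5 * g')); first by ring.
    by rewrite eB uG thu; ring.
  - apply/eqP; rewrite -subr_eq0; apply/eqP; apply: (@series_natI _ 3).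
    rewrite !sthM thh thH.
    transitivity (2%:R * h' * u ^+ 9 * (p * (2%:R * w' * g - 3%:R * w * g')
      + h' * 1728%:R * b)
      + 4%:R * h' * p * w' * u ^+ 5 * (1 - u ^+ 4 * g)
      + 6%:R * h' * p * w * u ^+ 4 * (4%:R * sth u + u ^+ 5 * g')
      - 3456%:R * h' ^+ 2 * b * u ^+ 9 * (1 - u ^+ 4 * g)).
      by ring.
    by rewrite eH uG thu; ring.
  (* The last polynomial hypothesis is this identity multiplied by 16 u^(-9). *)
  - have Pthu : 4%:R * (p * sth u) = - (p * g' * u ^+ 5) by rewrite mulrCA thu; ring.
    have thPthu : 4%:R * sth (p * sth u) =
      - (g2 * u ^+ 5 + p * g' * (5%:R * u ^+ 4 * sth u)).
      by rewrite -sth_natM Pthu sthN sthM thPG sthX.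
    apply/eqP; rewrite -subr_eq0; apply/eqP; apply: (@series_natI _ 15).
    transitivity (4%:R * p * (4%:R * sth (p * sth u)) + 16%:R * p * Z * u
      + 960%:R * h' ^+ 2 * g * u * (b * u ^+ 12)).
      by ring.
    rewrite thPthu.
    transitivity (u ^+ 9 * (5%:R * p ^+ 2 * g' ^+ 2 + 16%:R * p * Z * g ^+ 2
      - 4%:R * p * g2 * g + 960%:R * h' ^+ 2 * b)
      - 5%:R * p ^+ 2 * g' * u ^+ 4 * (4%:R * sth u + u ^+ 5 * g')
      - (4%:R * p * g2 * u ^+ 5) * (1 - u ^+ 4 * g)
        + 16%:R * p * Z * u * (1 - (u ^+ 4 * g) ^+ 2)
      - 960%:R * h' ^+ 2 * b * u ^+ 9 * (1 - u ^+ 4 * g)); first by ring.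
    by rewrite eG uG thu; ring.
  - transitivity (h' ^+ 2 * u ^+ 8 * (g ^+ 3 - (g ^+ 3 - w ^+ 2))); first by ring.
    rewrite BE; transitivity (h' ^+ 2 * g * ((u ^+ 4 * g) ^+ 2
      - 1728%:R * (b * u ^+ 12)) + h' ^+ 2 * 1728%:R * b * u ^+ 8 * (u ^+ 4 * g - 1));
      first by ring.
    by rewrite uG; ring.
have cE' : forall n, (c n.+1 * n.+1 ^ 2 = (1728 * n ^ 2 + 864 * n + 60) * c n)%N by [].
exists (pf_series u z c); split.
- exact: (pf_op_pf_series h1 h2 h3 h4 cE' z0 P0').
- exact: pf_series0.
- apply: pf_series_integral => //; apply: integralM => //; exact: integralX.
Qed.
End Pullback.

(** * Operators in normal form *)

Section NormalOperators.
Variable F : numFieldType.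
Implicit Types (L : diffop F) (Q q : {poly F}) (c : F).

(** Stated over a domain so as to apply over [{poly F}] too: bivariate identities then reduce to
    identities between values, within reach of [ring] and [field]. *)
Lemma poly_nat_ext (A : idomainType) (p q : {poly A}) :
    (forall n, n.+1%:R != 0 :> A) ->
  (forall n, p.[n%:R] = q.[n%:R]) -> p = q.
Proof.
move=> char0 pq; apply/eqP; rewrite -subr_eq0; apply/eqP.
apply: (@roots_geq_poly_eq0 _ _ [seq i%:R | i <- iota 0 (size (p - q))]).
- by apply/allP => _ /mapP[i _ ->]; rewrite /root hornerD hornerN pq subrr.
- rewrite map_inj_uniq ?iota_uniq // => i j.
  wlog: i j / (i <= j)%N => [W|ij].
    by case: (leqP i j) => [/W//|/ltnW/W W' /esym/W'].
  rewrite -{1}(subnKC ij) natrD -[LHS]addr0 => /addrI/eqP.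
  case E: (j - i)%N => [|k]; first by move=> _; lia.
  by rewrite eq_sym (negPf (char0 k)).
by rewrite size_map size_iota.
Qed.

Lemma poly_ext (p q : {poly F}) : (forall x, p.[x] = q.[x]) -> p = q.
Proof. by move=> pq; apply: poly_nat_ext => // n; rewrite pnatr_eq0. Qed.

Lemma biv_ext (P P' : {poly {poly F}}) :
  (forall x y, P.[y%:P].[x] = P'.[y%:P].[x]) -> P = P'.
Proof.
move=> PP; apply: poly_nat_ext => n; first by rewrite -polyC_natr polyC_eq0 pnatr_eq0.
by apply: poly_ext => x; rewrite -polyC_natr.
Qed.

(* t o (D o Q o D + q) *)
Definition normal_op Q q : diffop F := 'X *: (Q *: 'X^2 + Q^`() *: 'X + q%:P).

Lemma coef_normal_op Q q j :
  (normal_op Q q)`_j = 'X * [:: q; Q^`(); Q]`_j.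
Proof.
rewrite coefZ !coefD !coefZ coefXn coefX coefC.
by case: j => [|[|[|j]]]; rewrite /= ?(mulr0, mulr1, addr0, add0r, nth_nil).
Qed.

Lemma size_normal_op Q q : Q != 0 -> size (normal_op Q q) = 3.
Proof.
move=> Q0; apply/anti_leq/andP; split.
  apply/leq_sizeP => j j3; rewrite coef_normal_op nth_default ?mulr0 //.
rewrite ltnNge; apply/negP => /leq_sizeP/(_ 2 isT)/eqP.
by rewrite coef_normal_op mulf_eq0 polyX_eq0 (negPf Q0).
Qed.

Lemma lead_coef_normal_op Q q : Q != 0 -> lead_coef (normal_op Q q) = 'X * Q.
Proof. by move=> Q0; rewrite lead_coefE size_normal_op // coef_normal_op. Qed.

Lemma Dmul_scaleXn (p : {poly F}) n :
  Dmul (p *: 'X^n) = p^`() *: 'X^n + p *: 'X^(n.+1).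
Proof.
rewrite /Dmul -scalerAl -exprSr; congr (_ + _); apply/polyP => j.
rewrite coef_map_id0 ?raddf0 // !coefZ !coefXn.
by case: eqP; rewrite ?mulr1 // !mulr0 raddf0.
Qed.

Lemma Dmul_scaleX (p : {poly F}) : Dmul (p *: 'X) = p^`() *: 'X + p *: 'X^2.
Proof. exact: (Dmul_scaleXn p 1). Qed.

Lemma Dmul1 : Dmul (1 : diffop F) = 'X.
Proof.
have := Dmul_scaleXn 1 0; rewrite expr0 !scale1r => ->.
by rewrite -polyC1 derivC scale0r add0r.
Qed.

Lemma dmul_first_order (p : {poly F}) L : p != 0 -> dmul (p *: 'X) L = p *: Dmul L.
Proof.
move=> p0; rewrite /dmul size_scale // size_polyX 2!big_ord_recl big_ord0 /=.
by rewrite !coefZ !coefX /= mulr0 mulr1 scale0r add0r addr0.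
Qed.

(** Only theta^2 = t^2 D^2 + t D enters. *)
Lemma of_thetaE (a b c : {poly F}) :
  of_theta (a *: 'X^2 + b *: 'X + c%:P) =
  ('X ^+ 2 * a) *: 'X^2 + ('X * (a + b)) *: 'X + c%:P.
Proof.
set P := _ + c%:P.
have PE j : P`_j = [:: c; b; a]`_j.
  rewrite !coefD !coefZ coefXn coefX coefC.
  by case: j => [|[|[|j]]]; rewrite /= ?(mulr0, mulr1, addr0, add0r, nth_nil).
have sP : (size P <= 3)%N.
  by apply/leq_sizeP => j j3; rewrite PE nth_default.
transitivity (\sum_(j < 3) P`_j *: iter j (dmul (theta F)) 1).
  rewrite /of_theta -!(big_mkord xpredT (fun j => P`_j *: iter j (dmul (theta F)) 1)).
  rewrite [RHS](@big_cat_nat _ _ _ (size P)) //= [X in _ + X]big1_seq ?addr0 // =>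
    j /andP[_].
  by rewrite mem_index_iota => /andP[sj _]; rewrite (nth_default _ sj) scale0r.
rewrite 3!big_ord_recl big_ord0 addr0 /= !dmul_first_order ?polyX_eq0 // !PE /=.
rewrite Dmul1 Dmul_scaleX derivX.
rewrite !scalerDr !scalerA -!mul_polyC.
rewrite !(polyCD, polyCM); ring.
Qed.

Definition quad c0 c1 c3 : {poly F} := c0%:P + c1 *: 'X + c3 *: 'X^2.
Definition lin c2 c5 : {poly F} := c2%:P + c5 *: 'X.

(** This is c0 theta^2 + t (c1 (theta^2 + theta) + c2) + t^2 (c3 (theta^2 + 2 theta) + c5). The
    operators of the list fit because the exponents in their t^2 term add up to 2. *)
Definition normal5 c0 c1 c2 c3 c5 : diffop F :=
  normal_op ('X * quad c0 c1 c3) (lin c2 c5).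

Lemma of_theta_normal (P : {poly {poly F}}) c0 c1 c2 c3 c5 :
    (forall x y, P.[y%:P].[x] = c0 * y ^+ 2 + c1 * x * (y ^+ 2 + y) + c2 * x
       + c3 * x ^+ 2 * (y ^+ 2 + 2 * y) + c5 * x ^+ 2) ->
  of_theta P = normal5 c0 c1 c2 c3 c5.
Proof.
move=> PE; pose a := quad c0 c1 c3; pose b := c1 *: 'X + (2 * c3) *: 'X^2.
pose c := 'X * lin c2 c5.
have -> : P = a *: 'X^2 + b *: 'X + c%:P.
  apply: biv_ext => x y; rewrite PE /a /b /c /quad /lin !hornerE /=; ring.
rewrite of_thetaE /normal5 /normal_op.
have -> : 'X * quad c0 c1 c3 = 'X * a by [].
have -> : ('X * a)^`() = a + b.
  rewrite derivM derivX /a /b /quad !derivD !derivZ derivC derivX derivXn /=.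
  by rewrite -!mul_polyC polyCM; ring.
by rewrite /c -!mul_polyC !polyCM; ring.
Qed.

(** Substitution turns the prefactor t into alpha + lambda t and each D into D / lambda. Multiplying
    by kappa t on one side and by alpha + lambda t on the other exchanges the prefactors; kappa is a
    free normalization. *)
Lemma normal_op_shift Q q Q2 q2 alpha lambda kappa :
    lambda != 0 -> kappa != 0 -> Q != 0 ->
    Q2 = (kappa / lambda ^+ 2) *: (Q \Po affine alpha lambda) ->
    q2 = kappa *: (q \Po affine alpha lambda) ->
  left_equiv (shift_op alpha lambda (normal_op Q q)) (normal_op Q2 q2).
Proof.
move=> l0 k0 Q0 -> ->; exists (kappa *: 'X), (affine alpha lambda).
have a0 : affine alpha lambda != 0.
  apply/eqP => /polyP/(_ 1%N)/eqP.
  by rewrite coefD coefC coefZ coefX coef0 mulr1 add0r (negPf l0).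
have a' : (affine alpha lambda)^`() = lambda%:P.
  by rewrite derivD derivC derivZ derivX add0r alg_polyC.
split; rewrite ?scaler_eq0 ?negb_or ?k0 ?polyX_eq0 //.
apply/polyP => j; rewrite [LHS]coefZ [RHS]coefZ coef_normal_op /shift_op coef_poly
  size_normal_op //.
rewrite coef_normal_op derivZ deriv_comp a'.
case: j => [|[|[|j]]] /=; rewrite ?nth_nil ?mulr0 // comp_polyM comp_polyX.
- by rewrite -!mul_polyC invr1 polyC1; ring.
- rewrite -!mul_polyC; set Q' := _ \Po _; set A := affine _ _.
  transitivity ((kappa / lambda ^+ 1)%:P * 'X * A * Q').
    by rewrite polyCM; ring.
  rewrite (_ : kappa / lambda ^+ 1 = kappa / lambda ^+ 2 * lambda); last by field.
  by rewrite !polyCM; ring.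
rewrite -!mul_polyC polyCM; ring.
Qed.

(** The leading coefficient is t Q and that of D is t Q'. At a root of Q the former vanishes to one
    order more, as the root is simple; at 0 the orders are 2 and 1. *)
Lemma finite_singular_normal_op Q q x :
    Q != 0 -> root Q 0 -> (forall y, root Q y -> Q^`().[y] != 0) ->
  finite_singular (normal_op Q q) x = root Q x.
Proof.
move=> Q0 Q00 Qsep; rewrite /finite_singular lead_coef_normal_op //.
have XQ0 : 'X * Q != 0 by rewrite mulf_neq0 ?polyX_eq0.
have sL := size_normal_op q Q0.
apply/existsP/idP => [[j]|rx].
  apply: contraR => nrx; suff -> : mup x ('X * Q) = 0%N by rewrite expr0 dvd1p.
  apply/eqP; rewrite -leqn0 leqNgt mup_geq // expr1 dvdp_XsubCl rootM (negPf nrx) orbF.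
  by rewrite /root hornerX; apply: contra nrx => /eqP ->.
have lt1 : (1 < size (normal_op Q q))%N by rewrite sL.
exists (Ordinal lt1); rewrite coef_normal_op /=.
have [x0|x0] := eqVneq x 0.
  have m2 : (1 < mup x ('X * Q))%N.
    by rewrite mup_geq // x0 subr0 expr2 dvdp_mul // -(subr0 'X) -polyC0 dvdp_XsubCl.
  apply/negP => /(dvdp_trans (dvdp_exp2l _ m2)); rewrite x0 subr0 expr2.
  rewrite dvdp_mul2l ?polyX_eq0 // -(subr0 'X) -polyC0 dvdp_XsubCl.
  by apply/negP; apply: Qsep.
have m1 : (0 < mup x ('X * Q))%N by rewrite mup_geq // expr1 dvdp_XsubCl rootM rx orbT.
apply/negP => /(dvdp_trans (dvdp_exp2l _ m1)); rewrite expr1 dvdp_XsubCl rootM.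
by rewrite /root hornerX (negPf x0) /= (negPf (Qsep x rx)).
Qed.

Lemma quad_coef c0 c1 c3 j : (quad c0 c1 c3)`_j = [:: c0; c1; c3]`_j.
Proof.
rewrite !coefD !coefZ coefXn coefX coefC.
by case: j => [|[|[|j]]]; rewrite /= ?(mulr0, mulr1, addr0, add0r, nth_nil).
Qed.

Lemma lin_coef c2 c5 j : (lin c2 c5)`_j = [:: c2; c5]`_j.
Proof.
rewrite !coefD !coefZ coefX coefC.
by case: j => [|[|j]]; rewrite /= ?(mulr0, mulr1, addr0, add0r, nth_nil).
Qed.

(** In s = 1/t the leading coefficient is divisible by s^5, whereas the coefficient of D is s^4 (c0
    s^2 - c3), of order exactly 4. *)
Lemma singular_infty c0 c1 c2 c3 c5 : c3 != 0 ->
  singular (normal5 c0 c1 c2 c3 c5) None.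
Proof.
move=> c30; set L := normal5 _ _ _ _ _; rewrite /singular.
have Q0 : 'X * quad c0 c1 c3 != 0.
  by apply/eqP => /polyP/(_ 3%N)/eqP; rewrite coefXM quad_coef coef0 (negPf c30).
have sL : size L = 3 by apply: size_normal_op.
have L0 : L`_0 = 'X * lin c2 c5 by rewrite coef_normal_op.
have L1 : L`_1 = 'X * quad c0 (2 * c1) (3 * c3).
  rewrite coef_normal_op /=; congr (_ * _); apply/polyP => j.
  rewrite coef_deriv coefXM !quad_coef.
  by case: j => [|[|[|j]]]; rewrite /= ?nth_nil ?mul0rn // -mulr_natl; ring.
have L2 : L`_2 = 'X * ('X * quad c0 c1 c3) by rewrite coef_normal_op.
have s0 : (size (L`_0)%R <= 5)%N.
  by apply/leq_sizeP => -[|j] j5; rewrite L0 coefXM // lin_coef nth_default //=; lia.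
have s1 : (size (L`_1)%R <= 5)%N.
  by apply/leq_sizeP => -[|j] j5; rewrite L1 coefXM // quad_coef nth_default //=; lia.
have s2 : size L`_2 = 5%N.
  apply/anti_leq/andP; split.
    apply/leq_sizeP => -[|[|j]] j5; rewrite L2 !coefXM // quad_coef nth_default //=;
      lia.
  rewrite ltnNge; apply/negP => /leq_sizeP/(_ 4 isT)/eqP.
  by rewrite L2 !coefXM quad_coef (negPf c30).
have NE : (\max_(j < size L) size (L`_j)%R)%N = 5%N.
  have -> : (\max_(j < size L) size (L`_j)%R)%N =
      maxn (size (L`_0)%R) (maxn (size (L`_1)%R) (size (L`_2)%R)).
    by rewrite sL !big_ord_recl big_ord0 maxn0.
  by rewrite s2; apply/eqP; rewrite eqn_leq !geq_max s0 s1 leq_max leq_max leqnn !orbT.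
pose R j : {poly F} := \poly_(i < 6) L`_j`_(5 - i)%N.
have X0 : (- 'X^2 : {poly F}) != 0 by rewrite oppr_eq0 -size_poly_eq0 size_polyXn.
have dX : (- 'X^2 : {poly F})^`() = - (2 *: 'X).
  by rewrite derivN derivXn expr1 scaler_nat.
have -> : op_at_infty L = (R 0%N)%:A + R 1%N *: (- 'X^2 *: 'X) +
    R 2%N *: (- 'X^2 *: (- (2 *: 'X) *: 'X + (- 'X^2) *: 'X^2)).
  rewrite /op_at_infty NE sL !big_ord_recl big_ord0 addr0 addrA.
  by rewrite /= !dmul_first_order // Dmul1 Dmul_scaleX dX.
set M := _ + _.
have R1E : R 1%N = 'X^2 * quad (3 * c3) (2 * c1) c0.
  apply/polyP => j; rewrite coef_poly L1 coefXnM !coefXM !quad_coef.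
  by case: j => [|[|[|[|[|[|[|j]]]]]]].
have R2E : R 2%N = 'X * quad c3 c1 c0.
  apply/polyP => j; rewrite coef_poly L2 !coefXM !quad_coef.
  by case: j => [|[|[|[|[|[|[|j]]]]]]].
have R0E : R 0%N = 'X^3 * lin c5 c2.
  apply/polyP => j; rewrite coef_poly L0 coefXnM !coefXM !lin_coef.
  by case: j => [|[|[|[|[|[|[|j]]]]]]].
have ME j : M`_j = [:: R 0%N; 'X^4 * (c0 *: 'X^2 - c3%:P); 'X^5 * quad c3 c1 c0]`_j.
  rewrite /M R1E R2E /quad !coefD !coefZ !coefD !coefZ coefXn coefX coef1.
  case: j => [|[|[|j]]]; rewrite /= ?nth_nil ?(mulr0, addr0, add0r, mulr1, mul0r,
    raddf0, oppr0) //.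
    by rewrite -!mul_polyC !polyCM; ring.
  by rewrite -!mul_polyC; ring.
have T0 : quad c3 c1 c0 != 0.
  by apply/eqP => /polyP/(_ 0%N)/eqP; rewrite quad_coef coef0 (negPf c30).
have sM : size M = 3.
  apply/anti_leq/andP; split; first by apply/leq_sizeP => j j3; rewrite ME nth_default.
  rewrite ltnNge; apply/negP => /leq_sizeP/(_ 2 isT)/eqP.
  by rewrite ME /= mulf_eq0 -size_poly_eq0 size_polyXn (negPf T0).
have lM : lead_coef M = 'X^5 * quad c3 c1 c0 by rewrite lead_coefE sM ME.
have lM0 : lead_coef M != 0 by rewrite lM mulf_neq0 // -size_poly_eq0 size_polyXn.
have lt1 : (1 < size M)%N by rewrite sM.
rewrite /finite_singular; apply/existsP; exists (Ordinal lt1); rewrite ME /=.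
have m5 : (4 < mup 0 (lead_coef M))%N by rewrite mup_geq // lM subr0 dvdp_mulIl.
apply/negP => /(dvdp_trans (dvdp_exp2l _ m5)); rewrite subr0 exprSr.
rewrite dvdp_mul2l -?size_poly_eq0 ?size_polyXn // -(subr0 'X) -polyC0 dvdp_XsubCl.
by rewrite /root !hornerE /= oppr0 !mulr0 sub0r oppr_eq0 (negPf c30).
Qed.

Lemma singular_normal5 c0 c1 c2 c3 c5 beta gamma l :
    c3 != 0 -> beta != 0 -> gamma != 0 -> beta != gamma ->
    c1 = - (c3 * (beta + gamma)) -> c0 = c3 * beta * gamma ->
    unzip1 l =i [:: Some 0; Some beta; Some gamma; None] ->
  singular_points (normal5 c0 c1 c2 c3 c5) l.
Proof.
move=> c30 b0 g0 bg c1E c0E lE x; rewrite lE.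
have QE : 'X * quad c0 c1 c3 = c3 *: ('X * ('X - beta%:P) * ('X - gamma%:P)).
  by apply: poly_ext => y; rewrite /quad !hornerE /= c1E c0E; ring.
case: x => [x|]; last by rewrite singular_infty // !inE.
have rQ y : root ('X * quad c0 c1 c3) y = (y \in [:: 0; beta; gamma]).
  by rewrite QE rootZ // !rootM !root_XsubC /root hornerX !inE orbA.
rewrite /singular finite_singular_normal_op ?rQ ?inE ?eqxx //.
  by rewrite (inj_eq (@Some_inj _)) !(inj_eq (@Some_inj _)) orbF.
- by rewrite QE scaler_eq0 negb_or c30 !mulf_neq0 ?polyX_eq0 ?polyXsubC_eq0.
have dE y : ('X * quad c0 c1 c3)^`().[y] =
    c3 * ((y - beta) * (y - gamma) + y * (y - gamma) + y * (y - beta)).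
  by rewrite QE derivZ !derivM !derivB !derivC derivX !hornerE /=; ring.
have nz : beta - gamma != 0 by rewrite subr_eq0.
have nz' : gamma - beta != 0 by rewrite subr_eq0 eq_sym.
move=> y; rewrite rQ dE !inE mulf_eq0 negb_or c30 /=.
by case/or3P => /eqP ->; rewrite ?(subrr, sub0r, mulr0, mul0r, add0r,
  addr0) mulf_neq0 ?oppr_eq0.
Qed.

(** * Action on power series and the three-term recurrence *)

Lemma apply_op_normal5 c0 c1 c2 c3 c5 a : quad c0 c1 c3 != 0 ->
  apply_op (normal5 c0 c1 c2 c3 c5) a =
  pf_op (ser (quad c0 c1 c3)) (ser ('X * lin c2 c5)) a.
Proof.
move=> P0; set P := quad _ _ _ in P0 *; set q := lin _ _; set Q := 'X * P.
have Q0 : Q != 0 by rewrite mulf_neq0 ?polyX_eq0.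
pose D (b : series F) : series F := ser_deriv b.
transitivity (ser ('X * Q) * D (D a) + ser ('X * Q^`()) * D a + ser ('X * q) * a).
  apply: seriesP => n.
  pose G j := (ser (normal_op Q q)`_j * (iter j (@ser_deriv F) a : series F)) n.
  transitivity (\sum_(j < 3) G j); first by rewrite /apply_op size_normal_op.
  rewrite !big_ord_recl big_ord0 addr0 /G !coef_normal_op.
  by rewrite !coefsD [RHS]addrC [X in _ = _ + X]addrC.
suff -> : ser ('X * Q) * D (D a) + ser ('X * Q^`()) * D a = sth (ser P * sth a) by [].
rewrite !sthE -!/(D _).
have -> : ser P * (ser 'X * D a) = ser Q * D a by rewrite mulrA -rmorphM [P * _]mulrC.
have -> : D (ser Q * D a) = ser Q^`() * D a + ser Q * D (D a).
  by rewrite /D ser_derivM ser_deriv_ser.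
by rewrite !rmorphM /=; ring.
Qed.

(** The coefficient of t^(n+1) in (theta P theta + t q) a. The term n^2 - 1 is (n + 1)(n - 1), one
    factor from each theta. *)
Definition recurrence c0 c1 c2 c3 c5 (a : nat -> F) n :=
  c0 * n.+1%:R ^+ 2 * a n.+1 + (c1 * (n%:R * n.+1%:R) + c2) * a n
  + (if n is m.+1 then (c3 * (n%:R ^+ 2 - 1) + c5) * a m else 0).

Lemma pf_op_recurrence c0 c1 c2 c3 c5 (a : series F) n :
  pf_op (ser (quad c0 c1 c3)) (ser ('X * lin c2 c5)) a n =
  if n is m.+1 then recurrence c0 c1 c2 c3 c5 a m else 0.
Proof.
have qE b : ser (quad c0 c1 c3) * b =
   ser c0%:P * b + ser c1%:P * (ser 'X * b) + ser c3%:P * (ser 'X * (ser 'X * b)).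
  by rewrite /quad -!mul_polyC !rmorphD !rmorphM /=; ring.
have lE b : ser ('X * lin c2 c5) * b =
   ser c2%:P * (ser 'X * b) + ser c5%:P * (ser 'X * (ser 'X * b)).
  by rewrite /lin -!mul_polyC !rmorphM rmorphD !rmorphM /=; ring.
rewrite /pf_op qE lE [(sth _ + _) n]coefsD {1}/sth !coefsD !coefsCM !coefsXM.
case: n => [|n]; first by rewrite mul0r !mulr0 !addr0.
rewrite !coefsXM /sth /recurrence; case: n => [|n]; rewrite ?mul0r -?natr1; ring.
Qed.

Lemma normalized_solutionP c0 c1 c2 c3 c5 (a : nat -> F) : quad c0 c1 c3 != 0 ->
  normalized_solution (normal5 c0 c1 c2 c3 c5) a <->
  a 0%N = 1 /\ forall n, recurrence c0 c1 c2 c3 c5 a n = 0.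
Proof.
move=> P0; rewrite /normalized_solution apply_op_normal5 //; split=> -[a0 aE];
  split=> // n.
  by have := aE n.+1; rewrite pf_op_recurrence.
by rewrite pf_op_recurrence; case: n => // n; rewrite aE.
Qed.

Lemma recurrence_unique c0 c1 c2 c3 c5 (a b : nat -> F) N : c0 != 0 ->
    a 0%N = b 0%N ->
    (forall n, (n.+1 < N)%N -> recurrence c0 c1 c2 c3 c5 a n =
      recurrence c0 c1 c2 c3 c5 b n) ->
  forall n, (n < N)%N -> a n = b n.
Proof.
move=> c00 ab0 rec n; elim/ltn_ind: n => -[//|n] IHn nN.
have := rec n nN; rewrite /recurrence (IHn n) ?(ltnW nN) //.
case: n IHn nN {rec} => [|n] IHn nN; last rewrite (IHn n) ?(ltnW (ltnW nN)) //.
all: by move/addIr/addIr/mulfI; apply; rewrite mulf_neq0 // expf_neq0 // pnatr_eq0.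
Qed.

(** The factors of a_n and a_(n-1) are bounded by a constant times (n+1)^2, and dividing by c0
    (n+1)^2 leaves the constant K. The ratio 1 + K is at least 1, so one bound serves for both
    preceding terms. *)
Lemma recurrence_convergent c0 c1 c2 c3 c5 (a : nat -> F) : c0 != 0 ->
  (forall n, recurrence c0 c1 c2 c3 c5 a n = 0) -> convergent a.
Proof.
move=> c00 rec; pose K := (`|c1| + `|c2| + `|c3| + `|c5|) / `|c0|.
have n0 : 0 < `|c0| by rewrite normr_gt0.
have K0 : 0 <= K by rewrite divr_ge0 ?addr_ge0.
have r1 : 1 <= 1 + K by rewrite lerDl.
have r0 : 0 <= 1 + K by apply: le_trans r1.
exists `|a 0%N|, (1 + K) => n; elim/ltn_ind: n => -[|n] IHn;
  first by rewrite expr0 mulr1.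
pose B := `|a 0%N| * (1 + K) ^+ n; pose m : F := n.+1%:R.
have B0 : 0 <= B by rewrite mulr_ge0 ?exprn_ge0.
have m1 : 1 <= m by rewrite ler1n.
have m0 : 0 <= m by apply: le_trans m1.
have mm : 1 <= m ^+ 2 by rewrite exprn_ege1.
have bnd x y : `|x| <= B -> `|y| <= m ^+ 2 -> `|y * x| <= m ^+ 2 * B.
  by move=> xB ym; rewrite normrM ler_pM.
have t1 : `|(c1 * (n%:R * n.+1%:R) + c2) * a n| <= (`|c1| + `|c2|) * m ^+ 2 * B.
  rewrite normrM ler_pM ?IHn // (le_trans (ler_normD _ _)) // mulrDl lerD //.
    rewrite normrM ler_wpM2l // normrM !normr_nat expr2 ler_wpM2r //.
    by rewrite ler_nat.
  by rewrite ler_peMr.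
have t2 : `|if n is k.+1 then (c3 * (n%:R ^+ 2 - 1) + c5) * a k else 0| <= (`|c3|
  + `|c5|) * m ^+ 2 * B.
  case: n IHn @B @m B0 m1 m0 mm bnd t1 => [|n] IHn B m B0 m1 m0 mm bnd t1.
    by rewrite normr0 !mulr_ge0 ?addr_ge0.
  rewrite normrM ler_pM //.
    rewrite (le_trans (ler_normD _ _)) // mulrDl lerD //; last by rewrite ler_peMr.
    rewrite normrM ler_wpM2l // ger0_norm ?subr_ge0 ?exprn_ege1 ?ler1n //.
    by rewrite lerBlDr (le_trans _ (_ : m ^+ 2 <= _)) ?lerDl // lerXn2r ?nnegrE //
      ler_nat.
  apply: le_trans (IHn n _) _; first by lia.
  by rewrite /B exprSr mulrA ler_peMr // mulr_ge0 ?exprn_ge0.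
have : `|c0 * m ^+ 2 * a n.+1| <= (`|c1| + `|c2| + `|c3| + `|c5|) * m ^+ 2 * B.
  have -> : c0 * m ^+ 2 * a n.+1 = - ((c1 * (n%:R * n.+1%:R) + c2) * a n
    + (if n is k.+1 then (c3 * (n%:R ^+ 2 - 1) + c5) * a k else 0)).
    by apply/eqP; rewrite -subr_eq0 opprK addrA; apply/eqP/rec.
  rewrite normrN (le_trans (ler_normD _ _)) // (le_trans (lerD t1 t2)) //.
  by rewrite le_eqVlt; apply/orP; left; apply/eqP; ring.
rewrite 2!normrM [`|m ^+ 2|]ger0_norm ?exprn_ge0 // => le.
have {}le : `|a n.+1| <= K * B.
  rewrite -(ler_pM2l (_ : 0 < `|c0| * m ^+ 2)) ?mulr_gt0 ?(lt_le_trans _ mm) //.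
  apply: le_trans le _; rewrite le_eqVlt; apply/orP; left; apply/eqP.
  by rewrite /K; field; rewrite normr_eq0.
by rewrite exprSr mulrA -/B mulrC (le_trans le) // ler_wpM2r // lerDr.
Qed.
End NormalOperators.

(** * Elliptic surfaces *)

Section Affine.
Variable F : numFieldType.
Implicit Types (S : weierstrass F) (L M : diffop F) (p q : {poly F}).
Variables alpha lambda : F.
Hypothesis lambda_neq0 : lambda != 0.
Local Notation A := (affine alpha lambda).
Local Notation "p ^a" := (p \Po A) (at level 2).
Local Notation "f ^aa" := (map_poly (comp_poly A) f) (at level 2).

Lemma size_affine : size A = 2.
Proof.
rewrite /affine addrC size_polyDl size_scale ?size_polyX //.
exact: leq_ltn_trans (size_polyC_leq1 _) _.
Qed.

Lemma affine_comp_eq0 p : (p ^a == 0) = (p == 0).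
Proof. by rewrite -!size_poly_eq0 size_comp_poly2 ?size_affine. Qed.

Lemma affineK p : p ^a \Po affine (- alpha / lambda) lambda^-1 = p.
Proof.
rewrite -comp_polyA (_ : A \Po _ = 'X) ?comp_polyXr //.
apply: poly_ext => x; rewrite /affine horner_comp !hornerE /=; field.
exact: lambda_neq0.
Qed.

Lemma deriv_affine p : (p ^a)^`() = lambda *: (p^`()) ^a.
Proof.
rewrite deriv_comp derivD derivC derivZ derivX add0r alg_polyC.
by rewrite mulrC mul_polyC.
Qed.

Lemma map_deriv_affine (f : {poly {poly F}}) :
  map_poly (@deriv F) (f ^aa) = lambda%:P *: (map_poly (@deriv F) f) ^aa.
Proof.
apply/polyP => j; rewrite coefZ !coef_map /=.
by rewrite deriv_affine mul_polyC.
Qed.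

Lemma cubic_shift S : cubic (shift_surface alpha lambda S) = (cubic S) ^aa.
Proof.
rewrite /cubic !rmorphB /= map_polyC /=.
rewrite -!mul_polyC !rmorphM /= !map_polyC /= map_polyX /=.
by rewrite rmorph_nat; ring.
Qed.

(** By the chain rule each derivative contributes a lambda; [shift_op] carries the inverse power. *)
Lemma period_num_shift S j :
  period_num (shift_surface alpha lambda S) j =
    (lambda ^+ j)%:P *: (period_num S j) ^aa.
Proof.
elim: j => [|j IHj]; first by rewrite expr0 polyC1 scale1r /= rmorph1.
rewrite /= cubic_shift IHj map_deriv_affine.
have -> : map_poly (@deriv F) ((lambda ^+ j)%:P *: (period_num S j) ^aa) =
    (lambda ^+ j.+1)%:P *: (map_poly (@deriv F) (period_num S j)) ^aa.
  rewrite exprSr polyCM -scalerA -map_deriv_affine; apply/polyP => i.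
  by rewrite coef_map /= [in LHS]coefZ mul_polyC derivZ [in RHS]coefZ
    (coef_map (@deriv F)) mul_polyC.
move: (cubic S) (period_num S j) => C p.
rewrite -!mul_polyC rmorphB !rmorphM /= !map_polyC /= comp_polyC exprS !polyCM.
by ring.
Qed.

Lemma size_shift_op L : size (shift_op alpha lambda L) = size L.
Proof.
case: (posnP (size L)) => [s0|s0].
  by rewrite /shift_op s0; apply/eqP; rewrite -leqn0 size_poly.
rewrite /shift_op size_poly_eq // scaler_eq0 negb_or invr_eq0 expf_neq0 //=.
rewrite affine_comp_eq0 -lead_coefE lead_coef_eq0.
by rewrite -size_poly_eq0 -lt0n.
Qed.

Lemma annihilates_periods_shift L S : annihilates_periods L S ->
  annihilates_periods (shift_op alpha lambda L) (shift_surface alpha lambda S).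
Proof.
move=> [q [h [N [q0 sL E]]]]; exists (q ^a), (h ^aa), N.
rewrite size_shift_op affine_comp_eq0; split=> //; rewrite cubic_shift.
transitivity ((q *: (\sum_(j < size L) L`_j *: (period_num S j * cubic S ^+ (N - j)%N)))
  ^aa).
  rewrite -!mul_polyC rmorphM /= map_polyC /= rmorph_sum /=; congr (_ * _).
  apply: eq_bigr => j _; rewrite /shift_op coef_poly ltn_ord period_num_shift.
  have ll : (lambda ^- j)%:P%:P * (lambda%:P%:P) ^+ j = 1 :> {poly {poly F}}.
    by rewrite -!rmorphXn /= -!polyCM mulVf ?expf_neq0.
  move: (cubic S) (period_num S j) => C p.
  rewrite -!mul_polyC !rmorphM !rmorphXn /= map_polyC /=.
  by rewrite [RHS]mulrC -[RHS]mulr1 -ll; ring.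
rewrite E; move: (cubic S) => C.
by rewrite -!mul_polyC !deriv_map rmorphD !rmorphM /= map_polyC /= comp_polyC.
Qed.
End Affine.

(** * Transport of Picard-Fuchs operators and Kodaira fibres *)

Section SurfaceShift.
Variable F : numFieldType.
Implicit Types (S : weierstrass F) (L M : diffop F) (p q : {poly F}).

Lemma left_equiv_size L M : left_equiv L M -> size L = size M.
Proof. by move=> [p [q [p0 q0 E]]]; rewrite -(size_scale L p0) E size_scale. Qed.

Lemma annihilates_periods_left_equiv L M S :
  left_equiv L M -> annihilates_periods L S -> annihilates_periods M S.
Proof.
move=> LM [q [h [N [q0 sL E]]]]; move: (LM) => [a [b [a0 b0 ab]]].
exists (q * b), (a *: h), N; rewrite mulf_neq0 // -(left_equiv_size LM); split=> //.
transitivity (a *: (q *: (\sum_(j < size L) L`_j *: (period_num S j * cubic S ^+ (N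
  - j)%N)))).
  rewrite -[LHS]scalerA [RHS]scalerA [a * q]mulrC -[RHS]scalerA; congr (_ *: _).
  rewrite !scaler_sumr; apply: eq_bigr => j _; rewrite !scalerA; congr (_ *: _).
  by have := congr1 (fun K : diffop F => K`_j) ab; rewrite !coefZ => ->.
rewrite E derivZ -!mul_polyC; ring.
Qed.

Lemma shift_surfaceK alpha lambda S : lambda != 0 ->
  shift_surface (- alpha / lambda) lambda^-1 (shift_surface alpha lambda S) = S.
Proof. by move=> l0; case: S => a b; rewrite /shift_surface /= !affineK. Qed.

(** For minimality, an operator annihilating the shifted periods is carried back by the inverse
    shift, which preserves its order. *)
Lemma picard_fuchs_shift alpha lambda L M S : lambda != 0 ->
  left_equiv (shift_op alpha lambda L) M ->
  picard_fuchs S L -> picard_fuchs (shift_surface alpha lambda S) M.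
Proof.
move=> l0 LM [L0 aL minL]; have sLM := left_equiv_size LM;
  rewrite size_shift_op // in sLM.
split.
- by rewrite -size_poly_eq0 -sLM size_poly_eq0.
- exact: annihilates_periods_left_equiv LM (annihilates_periods_shift alpha l0 aL).
move=> L' L'0 /(annihilates_periods_shift (- alpha / lambda) (invr_neq0 l0)).
rewrite shift_surfaceK // => /minL; rewrite size_shift_op ?invr_eq0 // sLM; apply.
by rewrite -size_poly_eq0 size_shift_op ?invr_eq0 // size_poly_eq0.
Qed.

Lemma ord_ge_forall p n : ord_ge p n = [forall i : 'I_n, p`_i == 0].
Proof.
rewrite /ord_ge; apply/idP/forallP => [/dvdpP[q ->] i|p0].
  by rewrite coefMXn ltn_ord.
apply/dvdpP; exists (drop_poly n p); apply/polyP => i.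
rewrite coefMXn coef_drop_poly; case: ltnP => [iN|iN]; last by rewrite subnK.
exact/eqP/(p0 (Ordinal iN)).
Qed.

(** Orders agree as soon as, below any common vanishing order, the next coefficients vanish
    together; the lowest coefficients may differ by a unit. *)
Lemma ord_ge_transport p p' n :
    (forall m, (forall i, (i < m)%N -> p`_i = 0) -> (p'`_m == 0) = (p`_m == 0)) ->
  ord_ge p' n = ord_ge p n.
Proof.
move=> pp; have geS (r : {poly F}) m : ord_ge r m.+1 = ord_ge r m && (r`_m == 0).
  rewrite !ord_ge_forall; apply/forallP/andP => [r0|[/forallP r0 rm] [i im] /=].
    by split; [apply/forallP => i; apply: (r0 (widen_ord (leqnSn m) i))|apply:
      (r0 ord_max)].
  move: im; rewrite ltnS leq_eqVlt => /predU1P[-> //|im'].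
  exact: (r0 (Ordinal im')).
elim: n => [|n IHn]; first by rewrite /ord_ge expr0 !dvd1p.
rewrite !geS IHn; case: (boolP (ord_ge p n)) => //=.
by rewrite ord_ge_forall => /forallP p0; apply: pp => i im; apply/eqP/(p0 (Ordinal im)).
Qed.

Lemma tate_table_disc S K : tate_table S K -> disc S != 0.
Proof.
move=> t; apply/eqP => d0; move: t.
by case: K => [[|n]||||[|n]|||]; rewrite /tate_table d0 /ord_eq /ord_ge !dvdp0 /=
  ?andbF.
Qed.

Lemma size_disc d S :
    (size (g2 S) <= (4 * d).+1)%N -> (size (g3 S) <= (6 * d).+1)%N ->
  (size (disc S) <= (12 * d).+1)%N.
Proof.
move=> s2 s3; rewrite /disc (leq_trans (size_polyD _ _)) // geq_max size_polyN.
apply/andP; split; first by apply: leq_trans (size_poly_exp_leq _ _) _; move: s2;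
  move: (size (g2 S)) => n; lia.
apply: leq_trans (size_scale_leq _ _) _.
by apply: leq_trans (size_poly_exp_leq _ _) _; move: s3; move: (size (g3 S)) => n; lia.
Qed.

(** [T e] is a change of coordinate in weight e. The table sees only orders of g2, g3 and the
    discriminant, of weights 4, 6 and 12; d bounds their degrees. *)
Lemma tate_table_transport (T : nat -> {poly F} -> {poly F}) d S S' K :
    (forall e p n, (size p <= (e * d).+1)%N -> ord_ge (T e p) n = ord_ge p n) ->
    disc S' = T 12 (disc S) -> g2 S' = T 4 (g2 S) -> g3 S' = T 6 (g3 S) ->
    (size (g2 S) <= (4 * d).+1)%N -> (size (g3 S) <= (6 * d).+1)%N ->
  tate_table S' K = tate_table S K.
Proof.
move=> TE Ed E2 E3 s2 s3; have sd := size_disc s2 s3.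
by case: K => [[|n]||||[|n]|||]; rewrite /tate_table /ord_eq ?Ed ?E2 ?E3 !TE.
Qed.

Lemma poly_ext_neq0 (D p q : {poly F}) : D != 0 ->
  (forall x, D.[x] != 0 -> p.[x] = q.[x]) -> p = q.
Proof.
move=> D0 pq; apply: (mulfI D0); apply: poly_ext => x; rewrite !hornerM.
by have [->|/pq->//] := eqVneq D.[x] 0; rewrite !mul0r.
Qed.

Definition rev_poly m p : {poly F} := \poly_(i < m.+1) p`_(m - i)%N.

Lemma horner_rev m p x : (size p <= m.+1)%N -> x != 0 ->
  (rev_poly m p).[x] = x ^+ m * p.[x^-1].
Proof.
move=> sp x0; rewrite /rev_poly horner_poly (horner_coef_wide _ sp) mulr_sumr.
rewrite (reindex_inj rev_ord_inj) /=; apply: eq_bigr => i _.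
have im : (i <= m)%N by rewrite -ltnS.
rewrite subSS subKn // mulrCA; congr (_ * _).
by rewrite exprVn -expfB_cond ?(negPf x0).
Qed.

(** * The local model at infinity under a shift *)

Section Infinity.
Variables (alpha lambda : F) (l0 : lambda != 0).
Let W : {poly F} := lambda%:P + alpha *: 'X.

(* s |-> w^m p(s/w), where w = lambda + alpha s and s/w is the coordinate at infinity
   before the shift. *)
Definition infty_shift m p : {poly F} :=
  \sum_(i < m.+1) p`_i *: ('X^i * W ^+ (m - i)).

Lemma horner_W x : W.[x] = lambda + alpha * x.
Proof. by rewrite /W !hornerE. Qed.

Lemma horner_infty_shift m p x : (size p <= m.+1)%N -> W.[x] != 0 ->
  (infty_shift m p).[x] = W.[x] ^+ m * p.[x / W.[x]].
Proof.
move=> sp w0; rewrite /infty_shift horner_sum (horner_coef_wide _ sp) mulr_sumr.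
apply: eq_bigr => i _; rewrite hornerZ hornerM hornerXn horner_exp.
rewrite [RHS]mulrCA; congr (_ * _); rewrite exprMn mulrCA exprVn; congr (_ * _).
rewrite expfB_cond // (negPf w0) -ltnS; exact: ltn_ord.
Qed.

(** W(0) = lambda is non-zero, so the lowest term of p is only multiplied by a power of lambda. *)
Lemma ord_ge_infty_shift m p n : (size p <= m.+1)%N ->
  ord_ge (infty_shift m p) n = ord_ge p n.
Proof.
move=> sp; apply: ord_ge_transport => k p0.
have coefE i : (p`_i *: ('X^i * W ^+ (m - i)))`_k =
    if i == k then p`_k * lambda ^+ (m - k) else if (i < k)%N then 0 else 0.
  rewrite coefZ coefXnM; case: (ltngtP i k) => [ik|ki|->].
  - by rewrite p0 ?mul0r.
  - by rewrite mulr0.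
  rewrite subnn -horner_coef0 horner_exp /W !hornerE /=.
  by rewrite ?mulr0 ?addr0.
rewrite /infty_shift coef_sum.
case: (ltnP k m.+1) => [km|mk]; last first.
  rewrite [p`_k]nth_default ?(leq_trans sp) // eqxx big1 ?eqxx // => i _.
  rewrite coefE; case: eqP => [ik|_]; last by case: ifP.
  by have := ltn_ord i; rewrite ik ltnNge mk.
rewrite (bigD1 (Ordinal km)) //= coefE eqxx big1 => [|i]; last first.
  by rewrite coefE -val_eqE /= => /negPf ->; case: ifP.
by rewrite addr0 mulf_eq0 expf_eq0 (negPf l0) andbF orbF.
Qed.

Lemma infty_shift_disc d (S S' : weierstrass F) :
    (size (g2 S) <= (4 * d).+1)%N -> (size (g3 S) <= (6 * d).+1)%N ->
    g2 S' = infty_shift (4 * d) (g2 S) -> g3 S' = infty_shift (6 * d) (g3 S) ->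
  disc S' = infty_shift (12 * d) (disc S).
Proof.
move=> s2 s3 E2 E3; have sd := size_disc s2 s3; have W0 : W != 0.
  apply/eqP => /polyP/(_ 0%N)/eqP.
  by rewrite coefD coefC coefZ coefX coef0 mulr0 addr0 (negPf l0).
apply: (poly_ext_neq0 W0) => x wx.
have e2 : (g2 S').[x] = W.[x] ^+ (4 * d) * (g2 S).[x / W.[x]].
  by rewrite E2 horner_infty_shift.
have e3 : (g3 S').[x] = W.[x] ^+ (6 * d) * (g3 S).[x / W.[x]].
  by rewrite E3 horner_infty_shift.
rewrite horner_infty_shift //; move: (x / _) e2 e3 => y; move: (W.[x]) => w e2 e3.
rewrite /disc !(hornerD, hornerN, hornerZ, horner_exp) e2 e3 !exprMn -!exprM.
have -> : (4 * d * 3 = 12 * d)%N by rewrite mulnAC.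
have -> : (6 * d * 2 = 12 * d)%N by rewrite mulnAC.
by rewrite mulrBr; congr (_ - _); rewrite mulrCA.
Qed.

(** Rests on alpha + lambda/x = (x / W(x))^(-1). Checking it at points with x W(x) non-zero suffices
    for an identity of polynomials. *)
Lemma rev_poly_shift m k e p p0 : (size p <= m.+1)%N -> (m = k + e)%N ->
    rev_poly m p = 'X^k * p0 -> (size p0 <= e.+1)%N ->
  rev_poly m (p \Po affine alpha lambda) = 'X^k * infty_shift e p0.
Proof.
move=> sp mE pE s0; have W0 : 'X * W != 0.
  rewrite mulf_neq0 ?polyX_eq0 //; apply/eqP => /polyP/(_ 0%N)/eqP.
  by rewrite coefD coefC coefZ coefX coef0 mulr0 addr0 (negPf l0).
apply: (poly_ext_neq0 W0) => x; rewrite hornerM hornerX mulf_eq0 negb_or =>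
  /andP[x0 w0].
rewrite horner_rev ?size_comp_poly2 ?size_affine // horner_comp.
rewrite hornerM hornerXn horner_infty_shift //.
have y0 : x / W.[x] != 0 by rewrite mulf_neq0 ?invr_eq0.
have := congr1 (fun r : {poly F} => r.[x / W.[x]]) pE.
rewrite /= horner_rev // hornerM hornerXn.
have -> : (affine alpha lambda).[x^-1] = (x / W.[x])^-1.
  by rewrite invf_div horner_W /affine !hornerE; field.
set u := p.[_]; set v := p0.[_] => E.
apply: (mulfI (_ : W.[x]^-1 ^+ m != 0)); first by rewrite expf_neq0 ?invr_eq0.
transitivity ((x / W.[x]) ^+ m * u); first by rewrite exprMn; ring.
rewrite {}E mE exprD exprMn !exprVn; field.
by rewrite !expf_neq0.
Qed.
End Infinity.

Lemma size_shift_affine alpha lambda p : lambda != 0 ->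
  size (p \Po affine alpha lambda) = size p.
Proof. by move=> l0; rewrite size_comp_poly2 ?size_affine. Qed.

(** The number N of the local model depends only on sizes, which a shift preserves. The discriminant
    of [S0] being non-zero, g2 or g3 is non-zero and k <= N; then N - k bounds the degrees of [S0],
    as [infty_shift] requires. *)
Lemma has_fibre_infty_shift alpha lambda S K : lambda != 0 ->
  has_fibre S None K -> has_fibre (shift_surface alpha lambda S) None K.
Proof.
move=> l0 [k [S0 [/= E2 E3 t]]]; have d0 := tate_table_disc t.
rewrite /has_fibre /= !size_shift_affine //.
set N := maxn _ _ in E2 E3 *.
have sz c p p0 : rev_poly (c * N) p = 'X^(c * k) * p0 ->
    p0 != 0 -> (c * k + size p0 <= (c * N).+1)%N.
  move=> E p00; have : (size (rev_poly (c * N) p) <= (c * N).+1)%N by apply: size_poly.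
  by rewrite E size_monicM ?monicXn // size_polyXn addSn.
have kN : (k <= N)%N.
  have [z2|/(sz _ _ _ E2)] := eqVneq (g2 S0) 0; last by move: (size _) => n; lia.
  have [z3|/(sz _ _ _ E3)] := eqVneq (g3 S0) 0; last by move: (size _) => n; lia.
  by move: d0; rewrite /disc z2 z3 !expr0n /= scaler0 subr0 eqxx.
pose d := (N - k)%N.
have sd c p p0 : rev_poly (c * N) p = 'X^(c * k) * p0 -> (size p0 <= (c * d).+1)%N.
  have [->|p00 /sz/(_ p00)] := eqVneq p0 0; first by rewrite size_poly0.
  by rewrite /d mulnBr; move: (size _) => n; lia.
exists k, (Weierstrass (infty_shift alpha lambda (4 * d) (g2 S0))
                       (infty_shift alpha lambda (6 * d) (g3 S0))) => /=.
have s2 := sd _ _ _ E2; have s3 := sd _ _ _ E3.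
split.
- apply: rev_poly_shift => //; last by rewrite /d mulnBr; lia.
  by rewrite leqW // (leq_trans (leq_maxl _ (size (g3 S)))) // -/N; lia.
- apply: rev_poly_shift => //; last by rewrite /d mulnBr; lia.
  by rewrite leqW // (leq_trans (leq_maxr (size (g2 S)) _)) // -/N; lia.
rewrite (tate_table_transport (T := fun e =>
  infty_shift alpha lambda (e * d)) (d := d) (S := S0)) //.
  by move=> e p n; apply: ord_ge_infty_shift.
exact: infty_shift_disc.
Qed.

(** The old local coordinate is lambda s; the powers of lambda coming out of (lambda s)^(4k) and
    (lambda s)^(6k) are absorbed into the minimal model. *)
Lemma has_fibre_shift alpha lambda S x K : lambda != 0 ->
  has_fibre S (Some (alpha + lambda * x)) K ->
  has_fibre (shift_surface alpha lambda S) (Some x) K.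
Proof.
move=> l0 [k [S0 [/= E2 E3 t]]].
pose T e p := lambda ^+ (e * k) *: (p \Po (lambda *: 'X)).
have cE p : (p \Po affine alpha lambda) \Po affine x 1 =
    (p \Po affine (alpha + lambda * x) 1) \Po (lambda *: 'X).
  by apply: poly_ext => y; rewrite /affine !horner_comp !hornerE; congr (p.[_]); ring.
have TE e p : ('X^(e * k) * p) \Po (lambda *: 'X) = 'X^(e * k) * T e p.
  apply: poly_ext => y; rewrite /T !(horner_comp, hornerM, hornerZ, hornerXn, hornerX).
  by rewrite exprMn [_ * y ^+ _]mulrC mulrA.
exists k, (Weierstrass (T 4%N (g2 S0)) (T 6%N (g3 S0))) => /=; split.
- by rewrite cE E2 TE.
- by rewrite cE E3 TE.
pose d := maxn (size (g2 S0)) (size (g3 S0)).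
rewrite (tate_table_transport (T := T) (d := d) (S := S0)) //.
- move=> e p n _; apply: ord_ge_transport => m _.
  have -> : (T e p)`_m = lambda ^+ (e * k) * (lambda ^+ m * p`_m).
    rewrite coefZ; congr (_ * _); rewrite comp_polyE coef_sum.
    case: (ltnP m (size p)) => [mp|pm]; last first.
      rewrite nth_default // mulr0 big1 // => i _.
      rewrite exprZn !coefZ coefXn; case: eqP => [mi|]; last by rewrite !mulr0.
      by have := ltn_ord i; rewrite -mi ltnNge pm.
    rewrite (bigD1 (Ordinal mp)) //= big1 => [|i].
      by rewrite exprZn !coefZ coefXn eqxx addr0 mulr1 mulrC.
    rewrite -val_eqE /= eq_sym => /negPf im.
    by rewrite exprZn !coefZ coefXn im !mulr0.
  by rewrite !mulf_eq0 !expf_eq0 (negPf l0) !andbF.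
- rewrite /disc /T /=; apply: poly_ext => y.
  rewrite !(hornerD, hornerN, hornerZ, horner_exp, horner_comp) !exprMn -!exprM.
  rewrite (_ : 4 * k * 3 = 12 * k)%N 1?(_ : 6 * k * 2 = 12 * k)%N 1?mulnAC //.
  by rewrite mulrBr; congr (_ - _); rewrite mulrCA.
- by rewrite leqW // (leq_trans (leq_maxl _ (size (g3 S0)))) // -/d; lia.
by rewrite leqW // (leq_trans (leq_maxr (size (g2 S0)) _)) // -/d; lia.
Qed.
End SurfaceShift.

(** * Critical scaling *)

Section CriticalScaling.
Variable F : numFieldType.

(** Coefficients are kept as binary integers, so that the recurrence on the listed values is decided
    by evaluation. *)
Definition iz (z : Z) : F := (int_of_Z z)%:~R.

Lemma izD x y : iz (x + y) = iz x + iz y.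
Proof. by rewrite /iz (rmorphD int_of_Z) rmorphD. Qed.
Lemma izM x y : iz (x * y) = iz x * iz y.
Proof. by rewrite /iz (rmorphM int_of_Z) rmorphM. Qed.
Lemma izN x : iz (- x) = - iz x.
Proof. by rewrite /iz (rmorphN int_of_Z) rmorphN. Qed.
Lemma iz0 : iz Z0 = 0. Proof. by []. Qed.
Lemma iz1 : iz 1 = 1. Proof. by []. Qed.
Lemma izO p : iz (Zpos (xO p)) = 2 * iz (Zpos p).
Proof. exact: (izM (Zpos (xO xH)) (Zpos p)). Qed.
Lemma izI p : iz (Zpos (xI p)) = 2 * iz (Zpos p) + 1.
Proof. by rewrite -izO -(izD (Zpos (xO p)) (Zpos xH)). Qed.
Lemma izneg p : iz (Zneg p) = - iz (Zpos p).
Proof. exact: (izN (Zpos p)). Qed.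
Definition izE := (iz0, iz1 : iz (Zpos xH) = 1, izO, izI, izneg).

Lemma iz_eq0 z : (iz z == 0) = (z == Z0).
Proof. by rewrite /iz intr_eq0 -(inj_eq (can_inj int_of_ZK)). Qed.

Lemma iz_of_nat n : iz (Z.of_nat n) = n%:R.
Proof. by rewrite /iz (_ : int_of_Z _ = n) //; apply: (Z_of_intK n). Qed.

Lemma iz_of_N b : iz (Z.of_N b) = (nat_of_bin b)%:R.
Proof. by rewrite -iz_of_nat; congr iz; lia. Qed.

(* [recurrence] in a form that can be evaluated on binary numbers. *)
Definition Zrec (z0 z1 z2 z3 z5 : Z) (s : seq N) (k : nat) : Z :=
  let a i := Z.of_N (nth 0%num s i) in
  let n := Z.of_nat k in
  let m := Z.of_nat k.+1 in
  z0 * (m * m) * a k.+1 + (z1 * (n * m) + z2) * a k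
  + (if k is l.+1 then (z3 * (n * n - 1) + z5) * a l else 0).

Lemma iz_Zrec z0 z1 z2 z3 z5 s k :
  iz (Zrec z0 z1 z2 z3 z5 s k) = recurrence (iz z0) (iz z1) (iz z2) (iz z3) (iz z5)
    (fun i => (nat_of_bin (nth 0%num s i))%:R) k.
Proof.
rewrite /Zrec /recurrence !izD !izM !izD !izM !iz_of_N !iz_of_nat expr2.
congr (_ + _); case: k => // k.
by rewrite !(izD, izM, izN, iz_of_N, iz_of_nat) expr2 iz1.
Qed.

Definition critical_check (s : seq N) (k : nat) :=
  has (fun i => ~~ N.eqb (N.modulo (nth 0%num s i)
    (N.pow (bin_of_nat k) (bin_of_nat i))) 0)
    (iota 0 (size s)).

Lemma nat_of_bin_pow k i :
  nat_of_bin (N.pow (bin_of_nat k) (bin_of_nat i)) = (k ^ i)%N.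
Proof.
elim: i => // i IHi; have -> : bin_of_nat i.+1 = N.succ (bin_of_nat i) by lia.
rewrite N.pow_succ_r' expnS -IHi; move: (N.pow _ _) => b; lia.
Qed.

Lemma nat_of_bin_dvd a b : (nat_of_bin b %| nat_of_bin a)%N -> b <> 0%num ->
  N.modulo a b = 0%num.
Proof.
move=> /dvdnP[q qE] b0; have -> : a = N.mul (bin_of_nat q) b by lia.
by rewrite N.Div0.mod_mul.
Qed.

(** The index [j] marks a listed coefficient with small positive value [m]: integrality of phi(t/k)
    gives k <= k^j <= m <= 30, and [iota 2 29] runs through all such k > 1. *)
Lemma critically_scaled_of_recurrence (z0 z1 z2 z3 z5 : Z) (s : seq N) (j m : nat) :
    z0 != Z0 ->
    integral_solution (quad (iz z0) (iz z1) (iz z3)) ('X * lin (iz z2) (iz z5)) ->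
    nth 0%num s 0 = 1%num -> (1 < size s)%N ->
    all (fun k => Z.eqb (Zrec z0 z1 z2 z3 z5 s k) 0) (iota 0 (size s).-1) ->
    (0 < j < size s)%N -> (0 < m <= 30)%N -> nth 0%num s j = bin_of_nat m ->
    all (critical_check s) (iota 2 29) ->
  let M := normal5 (iz z0) (iz z1) (iz z2) (iz z3) (iz z5) in
  critically_scaled M /\
  exists phi, [/\ unique_solution M phi, integral phi & begins_with phi s].
Proof.
move=> z00 [phi [phiL phi0 phiz]] s0 s1 srec /andP[j0 js] /andP[m0 m30] sj crit M.
have c00 : iz z0 != 0 by rewrite iz_eq0.
have P0 : quad (iz z0) (iz z1) (iz z3) != 0.
  by apply/eqP => /polyP/(_ 0%N)/eqP; rewrite quad_coef coef0 (negPf c00).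
have phirec n : recurrence (iz z0) (iz z1) (iz z2) (iz z3) (iz z5) phi n = 0.
  by have := congr1 (fun a => a n.+1) phiL; rewrite pf_op_recurrence.
have usol : unique_solution M phi.
  split; first by apply/normalized_solutionP.
    exact: recurrence_convergent phirec.
  move=> a /(normalized_solutionP _ _ _ P0) [a0 arec] n.
  apply: (@recurrence_unique F (iz z0) (iz z1) (iz z2) (iz z3) (iz z5) _ _ n.+1 c00) =>
    //; first by rewrite a0.
  by move=> k _; rewrite arec phirec.
have beg : begins_with phi s.
  apply: (@recurrence_unique F (iz z0) (iz z1) (iz z2) (iz z3) (iz z5) _ _ _ c00) =>
    [|n ns]; first by rewrite phi0 s0.
  rewrite phirec -iz_Zrec; move/allP: srec => /(_ n).
  rewrite mem_iota add0n /= (_ : (n < _)%N) => [/(_ isT)/Z.eqb_eq -> //|].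
  by rewrite -ltnS prednK // (ltnW s1).
split; last by exists phi.
exists phi; split=> //; last by rewrite beg // ler0n.
move=> k k1 kint.
have dv i : (i < size s)%N -> (k ^ i %| nat_of_bin (nth 0%num s i))%N.
  move=> szi; have [z zE] := kint i; rewrite beg // in zE.
  have k0 : (k%:R ^+ i : F) != 0 by rewrite expf_neq0 // pnatr_eq0; lia.
  have : ((nat_of_bin (nth 0%num s i))%:Z)%:~R = (z * (k ^ i)%N%:Z)%:~R :> F.
    by rewrite rmorphM /= -zE -!pmulrn natrX mulfVK.
  move/intr_inj => e; apply/dvdnP; exists `|z|%N.
  by have := congr1 absz e; rewrite abszM !absz_nat.
have k30 : (k <= 30)%N.
  apply: leq_trans m30; apply: (@leq_trans (k ^ j));
    first by rewrite -[k in (k <= _)%N]expn1 leq_pexp2l //; lia.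
  by apply: dvdn_leq => //; have := dv j js; rewrite sj bin_of_natK.
have ck : critical_check s k by apply: (allP crit); rewrite mem_iota k1 /=; lia.
have /hasP[ i ] := ck; rewrite mem_iota /= => szi /negP; apply; apply/N.eqb_eq;
  apply: nat_of_bin_dvd.
  suff -> : nat_of_bin (N.pow (bin_of_nat k) (bin_of_nat i)) = (k ^ i)%N by apply: dv.
  exact: nat_of_bin_pow.
by apply: N.pow_nonzero; lia.
Qed.
End CriticalScaling.

(** * The platonic operators *)

Section PlatonicSolutions.
Variable F : numFieldType.

Lemma deriv_nat n : (n%:R : {poly F})^`() = 0.
Proof. by rewrite -polyC_natr derivC. Qed.

Lemma deriv_one : (1 : {poly F})^`() = 0.
Proof. exact: (deriv_nat 1). Qed.

Lemma derivXS n : ('X^(n.+1) : {poly F})^`() = n.+1%:R * 'X^n.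
Proof. by rewrite derivXn mulr_natl. Qed.

Lemma derivXnS (p : {poly F}) n : (p ^+ n.+1)^`() = n.+1%:R * p ^+ n * p^`().
Proof. by rewrite deriv_exp -mulr_natl /=; move: (p ^+ n) (p^`()) => a b; ring. Qed.

Lemma coef0_nat n : (n%:R : {poly F})`_0 = n%:R.
Proof. by rewrite -polyC_natr coefC. Qed.

Ltac constant_neq0 :=
  rewrite ?(coef0_nat, coef1, coefXn, coefX, coef0M, coefN, coefD) ?mulr0
    ?(oppr0, addr0) ?oner_eq0 ?pnatr_eq0.

Ltac integral_poly :=
  rewrite ?(rmorph_nat, rmorph0, rmorph1);
  repeat first [ exact: integral_seriesn | exact: (integral_seriesn _ 1)
  | exact: (integral_seriesn _ 0) | exact: integral_serX
  | rewrite rmorph_nat | rewrite rmorph1 | rewrite rmorphXn; apply: integralX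
  | rewrite rmorphB; apply: integralD; last apply: integralN
  | rewrite rmorphD; apply: integralD | rewrite rmorphN; apply: integralN
  | rewrite rmorphM; apply: integralM ].

Ltac poly_identity :=
  rewrite ?(deriv_nat, deriv_one, derivX, derivXS, derivXnS, derivD, derivN, derivM,
    deriv0); ring.

(* The series A, B, G, H below come from the models
     y^2 + xy + B y = x^3, y^2 = x^3 + A x^2 + 16 B x (up to a 2-isogeny)
   and y^2 = 4 x^3 - 12 G x - 8 H, normalized at the shifted origin. Ring literals are
   unary, whence the large coefficients in base 1000. *)
Lemma integral_solution_T3 :
  @integral_solution F (2 - 81 * 'X + 729 * 'X^2) ('X * (- 24 + 648 * 'X)).
Proof.
have [c cP] := hypergeometric3.
pose A : {poly F} := 1; pose B : {poly F} := 'X * (2 - 27 * 'X).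
(* The numbers 0 and 2 are x in A = 1 + 4 t x and h = P(0) * ord_0(B). *)
apply: (@integral_solution_sqrt F _ _ A B (A ^+ 2 - 27%:R * B) _ _ _ 0 2 _ _ c cP
  _ _ _ _ erefl erefl erefl); rewrite /A /B.
- by integral_poly.
- by integral_poly.
- by rewrite coefXM.
- by constant_neq0.
- by ring.
- by [].
- by poly_identity.
- by poly_identity.
Qed.

Lemma integral_solution_T2 :
  @integral_solution F (1 - 81 * 'X^2) ('X * (- 72 * 'X)).
Proof.
have [c cP] := hypergeometric3.
(* The curve y^2 + xy + B y = x^3 has discriminant B^3 (1 - 27 B), hence I_6 at 0 and I_1 at 1/9 and
   -1/9: it is 3-isogenous to the listed surface, which has the same Picard-Fuchs operator. *)
pose A : {poly F} := 1; pose B : {poly F} := 'X * (3 * 'X).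
apply: (@integral_solution_sqrt F _ _ A B (A ^+ 2 - 27%:R * B) _ _ _ 0 2 _ _ c cP
  _ _ _ _ erefl erefl erefl); rewrite /A /B.
- by integral_poly.
- by integral_poly.
- by rewrite coefXM.
- by constant_neq0.
- by ring.
- by [].
- by poly_identity.
- by poly_identity.
Qed.

Lemma integral_solution_O4 :
  @integral_solution F (3 - 112 * 'X + (1000 + 24) * 'X^2) ('X * (- 36 + 960 * 'X)).
Proof.
have [c cP] := hypergeometric4.
pose A : {poly F} := 1 - 24 * 'X; pose B : {poly F} := 'X * ('X * (64 * 'X - 3)).
apply: (@integral_solution_sqrt F _ _ A B (A ^+ 2 - 64%:R * B) _ _ _ (- 6) 6 _ _ c cP
  _ _ _ _ erefl erefl erefl); rewrite /A /B.
- by integral_poly.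
- by integral_poly.
- by rewrite coefXM.
- by constant_neq0.
- by ring.
- by [].
- by poly_identity.
- by poly_identity.
Qed.

Lemma integral_solution_O3 :
  @integral_solution F (1 - 20 * 'X + 64 * 'X^2) ('X * (- 6 + 60 * 'X)).
Proof.
have [c cP] := hypergeometric4.
(* Here A^2 - 64 B = (1 - 16 t)(1 - 4 t)^2. The fibres I_6, I_1, I_2 at 0, 1/16, 1/4 become the
   listed I_3, I_2, I_4 under a 2-isogeny. *)
pose A : {poly F} := 1 - 12 * 'X; pose B : {poly F} := 'X * (4 * 'X^2).
apply: (@integral_solution_sqrt F _ _ A B (A ^+ 2 - 64%:R * B) _ _ _ (- 3) 3 _ _ c cP
  _ _ _ _ erefl erefl erefl); rewrite /A /B.
- by integral_poly.
- by integral_poly.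
- by rewrite coefXM.
- by constant_neq0.
- by ring.
- by [].
- by poly_identity.
- by poly_identity.
Qed.

Lemma integral_solution_O2 :
  @integral_solution F (3 - 128 * 'X
    - (4 * 1000 + 96) * 'X^2) ('X * (- 36 - (3 * 1000 + 840) * 'X)).
Proof.
have [c cP] := hypergeometric4.
pose A : {poly F} := 1 + 192 * 'X; pose B : {poly F} := 'X * (3 + 64 * 'X)^+2.
apply: (@integral_solution_sqrt F _ _ A B (A ^+ 2 - 64%:R * B) _ _ _ 48 3 _ _ c cP
  _ _ _ _ erefl erefl erefl); rewrite /A /B.
- by integral_poly.
- by integral_poly.
- by rewrite coefXM.
- by constant_neq0.
- by ring.
- by [].
- by poly_identity.
- by poly_identity.
Qed.

Lemma integral_solution_I5 :
  @integral_solution F (2 - 59 * 'X + 432 * 'X^2) ('X * (- 20 + 420 * 'X)).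
Proof.
have [c cP] := hypergeometric6.
pose G : {poly F} := 1 - 40 * 'X + 520 * 'X^2 - (2 * 1000 + 160) * 'X^3.
pose H : {poly F} := 1 - 60 * 'X + (1000 + 380) * 'X^2 - (14 * 1000 + 840) * 'X^3
  + (70 * 1000 + 200) * 'X^4 - (93 * 1000 + 312) * 'X^5.
(* Up to a constant B is the discriminant; its factors display I_5 at 0, I_2 at 1/16 and I_3 at
   2/27. *)
pose B : {poly F} := 'X * ('X^4 * (1 - 16 * 'X) ^+ 2 * (2 - 27 * 'X) ^+ 3).
apply: (@integral_solution_fourth_root F _ _ G B H _ _ _ _ (- 5 + 65 * 'X
  - 270 * 'X^2) 10 c cP
  _ _ _ _ erefl erefl erefl erefl); rewrite /G /B /H.
- by integral_poly.
- by integral_poly.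
- by rewrite coefXM.
- by constant_neq0.
- by ring.
- by ring.
- by poly_identity.
- by poly_identity.
- by poly_identity.
Qed.

Lemma integral_solution_I3 :
  @integral_solution F (10 - 999 * 'X
    + (11 * 1000 + 664) * 'X^2) ('X * (- 300 + (11 * 1000 + 340) * 'X)).
Proof.
have [c cP] := hypergeometric6.
pose G : {poly F} := 1 - 120 * 'X + (3 * 1000 + 240) * 'X^2 + (174 * 1000 + 960) * 'X^3.
pose H : {poly F} := 1 - 180 * 'X + (10 * 1000 + 260) * 'X^2 - (612 * 1000 + 360) * 'X^3
  + ((25 * 1000 + 981) * 1000 + 560) * 'X^4 + ((68 * 1000 + 24) * 1000 + 448) * 'X^5.
pose B : {poly F} := 'X * ('X^2 * (5 - 432 * 'X) ^+ 2 * (2 - 27 * 'X) ^+ 5).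
apply: (@integral_solution_fourth_root F _ _ G B H _ _ _ _ (- 15 + 405 * 'X
  + (21 * 1000 + 870) * 'X^2) 30 c cP
  _ _ _ _ erefl erefl erefl erefl); rewrite /G /B /H.
- by integral_poly.
- by integral_poly.
- by rewrite coefXM.
- by constant_neq0.
- by ring.
- by ring.
- by poly_identity.
- by poly_identity.
- by poly_identity.
Qed.

Lemma integral_solution_I2 :
  @integral_solution F (5 - 352 * 'X
    - (6 * 1000 + 912) * 'X^2) ('X * (- 100 - (6 * 1000 + 720) * 'X)).
Proof.
have [c cP] := hypergeometric6.
pose G : {poly F} := 1 - 80 * 'X + (29 * 1000 + 440) * 'X^2 - (552 * 1000 + 960) * 'X^3.
pose H : {poly F} := 1 - 120 * 'X - (61 * 1000 + 440) * 'X^2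
  + ((3 * 1000 + 829) * 1000 + 760) * 'X^3 - ((168 * 1000 + 99) * 1000 + 840) * 'X^4
  + ((382 * 1000 + 205) * 1000 + 952) * 'X^5.
pose B : {poly F} := 'X * ('X * (5 - 432 * 'X) ^+ 3 * (1 + 16 * 'X) ^+ 5).
apply: (@integral_solution_fourth_root F _ _ G B H _ _ _ _ (- 10 + (3 * 1000 + 680) * 'X
  - (69 * 1000 + 120) * 'X^2) 10 c cP
  _ _ _ _ erefl erefl erefl erefl); rewrite /G /B /H.
- by integral_poly.
- by integral_poly.
- by rewrite coefXM.
- by constant_neq0.
- by ring.
- by ring.
- by poly_identity.
- by poly_identity.
- by poly_identity.
Qed.

End PlatonicSolutions.

(* The key Z is taken by the integers of MathComp. *)
Delimit Scope Z_scope with coqZ.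

(** * Reduction of a critical shift to conditions on constants *)

Section CriticalShift.
Variable F : numFieldType.

Definition affine_point (alpha lambda : F) (y : option F * kodaira) :=
  (omap (fun x => alpha + lambda * x) y.1, y.2).

Lemma has_fibres_In (S : weierstrass F) l y :
  has_fibres S l -> List.In y l -> has_fibre S y.1 y.2.
Proof. by elim: l => //= -[x K] l IHl [f fs] [<-|/(IHl fs)]. Qed.

Lemma has_fibres_shift alpha lambda (S : weierstrass F) l l' : lambda != 0 ->
    (forall y, List.In y l' -> List.In (affine_point alpha lambda y) l) ->
  has_fibres S l -> has_fibres (shift_surface alpha lambda S) l'.
Proof.
move=> l0 ll fs; elim: l' ll => //= -[x K] l' IHl' ll; split; last first.
  by apply: IHl' => y yl; apply: ll; right.
have := has_fibres_In fs (ll (x, K) (or_introl erefl)); case: x {ll} => [x|] /=.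
  exact: has_fibre_shift.
exact: has_fibre_infty_shift.
Qed.

Lemma surface_of_shift alpha lambda (L M : diffop F) l l' (S : weierstrass F) :
    lambda != 0 -> left_equiv (shift_op alpha lambda L) M ->
    (forall y, List.In y l' -> List.In (affine_point alpha lambda y) l) ->
  surface_of L l S -> surface_of M l' (shift_surface alpha lambda S).
Proof.
move=> l0 LM ll [dS pS fS]; split.
- rewrite (_ : disc _ = disc S \Po affine alpha lambda) ?affine_comp_eq0 //.
  apply: poly_ext => x; rewrite horner_comp /disc /=.
  by rewrite !(hornerD, hornerN, hornerZ, horner_exp, horner_comp).
- exact: picard_fuchs_shift LM pS.
exact: has_fibres_shift fS.
Qed.

(** The substitution in t P and q, stated pointwise and without division by lambda^2, so that
    [field] can decide it. *)
Definition fits_normal5 (alpha lambda kappa c0 c1 c2 c3 c5 b0 b1 b2 b3 b5 : F) :=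
  forall x, let y := alpha + lambda * x in
  x * (b0 + b1 * x + b3 * x ^+ 2) * lambda ^+ 2 =
    kappa * (y * (c0 + c1 * y + c3 * y ^+ 2)) /\
  b2 + b5 * x = kappa * (c2 + c5 * y).

Lemma critical_shift_normal5 (c0 c1 c2 c3 c5 alpha lambda kappa : F) (L M : diffop F)
    (z0 z1 z2 z3 z5 : Z) s l l' (beta gamma : F) j m :
    L = normal5 c0 c1 c2 c3 c5 ->
    M = normal5 (iz F z0) (iz F z1) (iz F z2) (iz F z3) (iz F z5) ->
    lambda != 0 -> kappa != 0 -> c3 != 0 ->
    fits_normal5 alpha lambda kappa c0 c1 c2 c3 c5
      (iz F z0) (iz F z1) (iz F z2) (iz F z3) (iz F z5) ->
    z0 != Z0 -> z3 != Z0 ->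
    integral_solution (quad (iz F z0) (iz F z1) (iz F z3))
      ('X * lin (iz F z2) (iz F z5)) ->
    [&& nth 0%num s 0 == 1%num, (1 < size s)%N,
        all (fun k => Z.eqb (Zrec z0 z1 z2 z3 z5 s k) 0%coqZ) (iota 0 (size s).-1),
        (0 < j < size s)%N, (0 < m <= 30)%N, nth 0%num s j == bin_of_nat m
      & all (critical_check s) (iota 2 29)] ->
    beta != 0 -> gamma != 0 -> beta != gamma ->
    iz F z1 = - (iz F z3 * (beta + gamma)) -> iz F z0 = iz F z3 * beta * gamma ->
    unzip1 l' = [:: Some 0; Some beta; Some gamma; None] ->
    (forall y, List.In y l' -> List.In (affine_point alpha lambda y) l) ->
  critical_shift L l alpha M s l'.
Proof.
move=> -> -> l0 k0 c30 fits z00 z30 sol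
  /and5P[/eqP s0 s1 srec js /and3P[m30 /eqP sj crit]].
move=> b0 g0 bg e1 e0 ul ll; exists lambda => //.
have z3' : iz F z3 != 0 by rewrite iz_eq0.
have [Mcrit Mphi] := critically_scaled_of_recurrence z00 sol s0 s1 srec js m30 sj crit.
have LM : left_equiv (shift_op alpha lambda (normal5 c0 c1 c2 c3 c5))
    (normal5 (iz F z0) (iz F z1) (iz F z2) (iz F z3) (iz F z5)).
  apply: (normal_op_shift (kappa := kappa)) => //.
  - apply/eqP => /polyP/(_ 3%N)/eqP.
    by rewrite coefXM quad_coef coef0 (negPf c30).
  - apply: poly_ext => x; have [e _] := fits x.
    rewrite /quad /affine !(hornerZ, horner_comp, hornerD, hornerM, hornerX, hornerC,
      hornerXn).
    apply: (mulIf (_ : lambda ^+ 2 != 0)); first by rewrite expf_neq0.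
    by rewrite e mulrAC divfK // expf_neq0.
  apply: poly_ext => x; have [_ e] := fits x.
  by rewrite /lin /affine !(hornerZ, horner_comp, hornerD, hornerX, hornerC).
split=> //.
- by apply: (singular_normal5 _ _ z3' b0 g0 bg e1 e0) => x; rewrite ul.
by move=> S; apply: surface_of_shift.
Qed.

End CriticalShift.

(** * The eight critical shifts *)

Section Platonic.
Variable F : numFieldType.

Lemma horner_natr (A : nzRingType) (n : nat) (x : A) : (n%:R : {poly A}).[x] = n%:R.
Proof. by rewrite -polyC_natr hornerC. Qed.

(** Replaces the fractional exponents by the single constant [k5], so that the remaining comparison
    has integer coefficients. *)
Lemma indicial_factor (k k5 a b x y : F) : a + b = 2 -> k * (a * b) = k5 ->
  k * x ^+ 2 * (y + a) * (y + b) = k * x ^+ 2 * (y ^+ 2 + 2 * y) + k5 * x ^+ 2.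
Proof. by move=> <- <-; ring. Qed.

Ltac normal_form k5 :=
  apply: of_theta_normal => x y; rewrite /pt /ptheta /pcst;
  rewrite !(horner_natr, hornerXn, horner_exp, hornerX, hornerC, hornerN, hornerD,
    hornerM);
  rewrite (@indicial_factor _ k5); [rewrite ?izE; ring | field | field].

Ltac nonzero :=
  rewrite ?(oppr_eq0, mulf_eq0, invr_eq0, expf_eq0, pnatr_eq0, oner_eq0, negb_or) /=;
  by do ?[apply/andP; split].

Ltac same_fibre := left; congr (Some _, _); first [reflexivity | by field].

Ltac fibre := rewrite /affine_point /=; first
  [ solve [same_fibre] | solve [right; same_fibre] | solve [right; right; same_fibre]
  | right; right; right; left; reflexivity ].

Lemma L_T_normal (r : F) : L_T r = normal5 (r ^+ 3) 0 0 (- 27) (- 24).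
Proof. by normal_form (24 : F). Qed.

Lemma L_O_normal (r : F) :
  L_O r = normal5 (4 * r ^+ 4) (- 28 * r ^+ 2) (- 9 * r ^+ 2) 48 45.
Proof. by normal_form (45 : F). Qed.

Lemma L_I_normal (r : F) :
  L_I r = normal5 (20 * r ^+ 6) (88 * r ^+ 3) (25 * r ^+ 3) (- 108) (- 105).
Proof. by normal_form (105 : F). Qed.

Lemma root_cube (r rho : F) : rho ^+ 2 = (r / 3) ^+ 3 -> r ^+ 3 = 27 * rho ^+ 2.
Proof. by move=> ->; field. Qed.

Lemma root_cube_neq0 (r rho : F) : r != 0 -> rho ^+ 2 = (r / 3) ^+ 3 -> rho != 0.
Proof.
move=> r0 e; apply: contra_neq (_ : (r / 3) ^+ 3 != 0); last by nonzero.
by move=> rho0; rewrite -e rho0 expr0n.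
Qed.

Lemma singular_points_L_T (r rho : F) : r != 0 -> rho ^+ 2 = (r / 3) ^+ 3 ->
  singular_points (L_T r) (fibres_T rho).
Proof.
move=> r0 e; have rho0 := root_cube_neq0 r0 e; rewrite L_T_normal (root_cube e).
apply: (@singular_normal5 F _ _ _ _ _ rho (- rho)) => //; [nonzero|nonzero| |ring|ring].
by rewrite -subr_eq0 (_ : _ - _ = 2 * rho); [nonzero|ring].
Qed.

Lemma singular_points_L_O (r : F) : r != 0 -> singular_points (L_O r) (fibres_O r).
Proof.
move=> r0; rewrite L_O_normal.
apply: (@singular_normal5 F _ _ _ _ _ (r ^+ 2 / 4) (r ^+ 2 / 3)) => //.
- by nonzero.
- by nonzero.
- by nonzero.
- by rewrite -subr_eq0 (_ : _ - _ = - (r ^+ 2 / 12)); [nonzero|field].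
- by field.
by field.
Qed.

Lemma singular_points_L_I (r : F) : r != 0 -> singular_points (L_I r) (fibres_I r).
Proof.
move=> r0; rewrite L_I_normal.
apply: (@singular_normal5 F _ _ _ _ _ (- 5 * r ^+ 3 / 27) (r ^+ 3)) => //.
- by nonzero.
- by nonzero.
- by nonzero.
- by rewrite -subr_eq0 (_ : _ - _ = - (32 * r ^+ 3 / 27)); [nonzero|field].
- by field.
by field.
Qed.

Lemma critical_shift_T3 (r rho : F) : r != 0 -> rho ^+ 2 = (r / 3) ^+ 3 ->
  let t := pt F in let th := ptheta F in let c := @pcst F in
  critical_shift (L_T r) (fibres_T rho) rho
    (of_theta (2 * th ^+ 2 - 3 * t * (27 * th ^+ 2 + 27 * th + 8)
           + 3 ^+ 6 * t ^+ 2 * (th + c (2 / 3)) * (th + c (4 / 3))))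
    [:: 1; 12; 198; 3720; 75690; 1626912; 36376704; 837364176]%num
    [:: (Some 0, KI 3); (Some (1 / 27), KI 2); (Some (2 / 27), KI 3);
            (None, KIV)].
Proof.
move=> r0 e t th c; have rho0 := root_cube_neq0 r0 e.
have LE : L_T r = normal5 (27 * rho ^+ 2) 0 0 (- 27) (- 24).
  by rewrite L_T_normal (root_cube e).
(* lambda is read off from the listed positions: t = 0 and t = - rho must go to 1/27 and 2/27. Then
   kappa follows from the t-coefficients of q, here 648 = kappa * (-24) * lambda. The other cases
   are found in the same way. *)
apply: (@critical_shift_normal5 F _ _ _ _ _ _ (- 27 * rho) (rho^-1) _ _
  2%coqZ (-81)%coqZ (-24)%coqZ 729%coqZ 648%coqZ _ _ _ (1 / 27) (2 / 27) 1 12 LE) => //.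
- by normal_form (648 : F).
- by nonzero.
- by nonzero.
- by nonzero.
- by move=> x /=; split; rewrite !izE; field.
- have -> : quad (iz F 2%coqZ) (iz F (-81)%coqZ) (iz F 729%coqZ) = 2 - 81 * 'X
  + 729 * 'X^2.
    apply: poly_ext => x; rewrite /quad.
    rewrite !(horner_natr, hornerC, hornerZ, hornerXn, hornerX, hornerN, hornerD,
      hornerM) !izE.
    by ring.
  have -> : 'X * lin (iz F (-24)%coqZ) (iz F 648%coqZ) = 'X * (- 24 + 648 * 'X).
    apply: poly_ext => x; rewrite /lin.
    rewrite !(horner_natr, hornerC, hornerZ, hornerXn, hornerX, hornerN, hornerD,
      hornerM) !izE.
    by ring.
  exact: integral_solution_T3.
- by nonzero.
- by nonzero.
- by rewrite -subr_eq0 (_ : _ - _ = - (1 / 27)); [nonzero|field].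
- by rewrite !izE; field.
- by rewrite !izE; field.
by move=> y /=; case=> [<-|[<-|[<-|[<-|[]]]]]; fibre.
Qed.

Lemma critical_shift_T2 (r rho : F) : r != 0 -> rho ^+ 2 = (r / 3) ^+ 3 ->
  let t := pt F in let th := ptheta F in let c := @pcst F in
  critical_shift (L_T r) (fibres_T rho) 0
    (of_theta (th ^+ 2
           - 3 ^+ 4 * t ^+ 2 * (th + c (2 / 3)) * (th + c (4 / 3))))
    [:: 1; 0; 18; 0; 810; 0; 45360; 0; 2806650; 0; 183891708; 0]%num
    [:: (Some 0, KI 2); (Some (1 / 9), KI 3); (Some (- (1 / 9)), KI 3);
            (None, KIV)].
Proof.
move=> r0 e t th c; have rho0 := root_cube_neq0 r0 e.
have LE : L_T r = normal5 (27 * rho ^+ 2) 0 0 (- 27) (- 24).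
  by rewrite L_T_normal (root_cube e).
(* Since a_1 = 0, the bound on k comes from a_2 = 18. *)
apply: (@critical_shift_normal5 F _ _ _ _ _ _ (9 * rho) ((3 * rho)^-1) _ _
  1%coqZ 0%coqZ 0%coqZ (-81)%coqZ (-72)%coqZ _ _ _ (1 / 9) (- (1 / 9)) 2 18 LE) => //.
- by normal_form (72 : F).
- by nonzero.
- by nonzero.
- by nonzero.
- by move=> x /=; split; rewrite !izE; field.
- have -> : quad (iz F 1%coqZ) (iz F 0%coqZ) (iz F (-81)%coqZ) = 1 - 81 * 'X^2.
    apply: poly_ext => x; rewrite /quad.
    rewrite !(horner_natr, hornerC, hornerZ, hornerXn, hornerX, hornerN, hornerD,
      hornerM) !izE.
    by ring.
  have -> : 'X * lin (iz F 0%coqZ) (iz F (-72)%coqZ) = 'X * (- 72 * 'X).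
    apply: poly_ext => x; rewrite /lin.
    rewrite !(horner_natr, hornerC, hornerZ, hornerXn, hornerX, hornerN, hornerD,
      hornerM) !izE.
    by ring.
  exact: integral_solution_T2.
- by nonzero.
- by nonzero.
- by rewrite -subr_eq0 (_ : _ - _ = (2 / 9)); [nonzero|field].
- by rewrite !izE; field.
- by rewrite !izE; field.
by move=> y /=; case=> [<-|[<-|[<-|[<-|[]]]]]; fibre.
Qed.

Lemma critical_shift_O4 (r : F) : r != 0 ->
  let t := pt F in let th := ptheta F in let c := @pcst F in
  critical_shift (L_O r) (fibres_O r) 0
    (of_theta (3 * th ^+ 2 - 4 * t * (28 * th ^+ 2 + 28 * th + 9)
           + 2 ^+ 10 * t ^+ 2 * (th + c (3 / 4)) * (th + c (5 / 4))))
    [:: 1; 12; 180; 2928; 49860; 875952; 15754704; 288722880]%num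
    [:: (Some 0, KI 4); (Some (3 / 64), KI 2); (Some (1 / 16), KI 3);
            (None, KIII)].
Proof.
move=> r0 t th c.
have LE : L_O r = normal5 (4 * r ^+ 4) (- 28 * r ^+ 2) (- 9 * r ^+ 2) 48 45.
  exact: L_O_normal.
apply: (@critical_shift_normal5 F _ _ _ _ _ _ (16 * r ^+ 2 / 3) (4 / r ^+ 2) _ _
  3%coqZ (-112)%coqZ (-36)%coqZ 1024%coqZ 960%coqZ _ _ _ (3 / 64) (1 / 16) 1 12 LE) =>
    //.
- by normal_form (960 : F).
- by nonzero.
- by nonzero.
- by nonzero.
- by move=> x /=; split; rewrite !izE; field.
- have -> : quad (iz F 3%coqZ) (iz F (-112)%coqZ) (iz F 1024%coqZ) = 3 - 112 * 'X
  + (1000 + 24) * 'X^2.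
    apply: poly_ext => x; rewrite /quad.
    rewrite !(horner_natr, hornerC, hornerZ, hornerXn, hornerX, hornerN, hornerD,
      hornerM) !izE.
    by ring.
  have -> : 'X * lin (iz F (-36)%coqZ) (iz F 960%coqZ) = 'X * (- 36 + 960 * 'X).
    apply: poly_ext => x; rewrite /lin.
    rewrite !(horner_natr, hornerC, hornerZ, hornerXn, hornerX, hornerN, hornerD,
      hornerM) !izE.
    by ring.
  exact: integral_solution_O4.
- by nonzero.
- by nonzero.
- by rewrite -subr_eq0 (_ : _ - _ = - (1 / 64)); [nonzero|field].
- by rewrite !izE; field.
- by rewrite !izE; field.
by move=> y /=; case=> [<-|[<-|[<-|[<-|[]]]]]; fibre.
Qed.

Lemma critical_shift_O3 (r : F) : r != 0 ->
  let t := pt F in let th := ptheta F in let c := @pcst F in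
  critical_shift (L_O r) (fibres_O r) (r ^+ 2 / 3)
    (of_theta (th ^+ 2 - 2 * t * (10 * th ^+ 2 + 10 * th + 3)
           + 2 ^+ 6 * t ^+ 2 * (th + c (3 / 4)) * (th + c (5 / 4))))
    [:: 1; 6; 54; 588; 7110; 91476; 1224636; 16849944; 236523078]%num
    [:: (Some 0, KI 3); (Some (1 / 16), KI 2); (Some (1 / 4), KI 4);
            (None, KIII)].
Proof.
move=> r0 t th c.
have LE : L_O r = normal5 (4 * r ^+ 4) (- 28 * r ^+ 2) (- 9 * r ^+ 2) 48 45.
  exact: L_O_normal.
apply: (@critical_shift_normal5 F _ _ _ _ _ _ (- 4 * r ^+ 2 / 3) (- 1 / r ^+ 2) _ _
  1%coqZ (-20)%coqZ (-6)%coqZ 64%coqZ 60%coqZ _ _ _ (1 / 16) (1 / 4) 1 6 LE) => //.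
- by normal_form (60 : F).
- by nonzero.
- by nonzero.
- by nonzero.
- by move=> x /=; split; rewrite !izE; field.
- have -> : quad (iz F 1%coqZ) (iz F (-20)%coqZ) (iz F 64%coqZ) = 1 - 20 * 'X
  + 64 * 'X^2.
    apply: poly_ext => x; rewrite /quad.
    rewrite !(horner_natr, hornerC, hornerZ, hornerXn, hornerX, hornerN, hornerD,
      hornerM) !izE.
    by ring.
  have -> : 'X * lin (iz F (-6)%coqZ) (iz F 60%coqZ) = 'X * (- 6 + 60 * 'X).
    apply: poly_ext => x; rewrite /lin.
    rewrite !(horner_natr, hornerC, hornerZ, hornerXn, hornerX, hornerN, hornerD,
      hornerM) !izE.
    by ring.
  exact: integral_solution_O3.
- by nonzero.
- by nonzero.
- by rewrite -subr_eq0 (_ : _ - _ = - (3 / 16)); [nonzero|field].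
- by rewrite !izE; field.
- by rewrite !izE; field.
by move=> y /=; case=> [<-|[<-|[<-|[<-|[]]]]]; fibre.
Qed.

Lemma critical_shift_O2 (r : F) : r != 0 ->
  let t := pt F in let th := ptheta F in let c := @pcst F in
  critical_shift (L_O r) (fibres_O r) (r ^+ 2 / 4)
    (of_theta (3 * th ^+ 2 - 4 * t * (32 * th ^+ 2 + 32 * th + 9)
           - 2 ^+ 12 * t ^+ 2 * (th + c (3 / 4)) * (th + c (5 / 4))))
    [:: 1; 12; 612; 25392; 1298340; 67041072; 3633970704]%num
    [:: (Some 0, KI 2); (Some (1 / 64), KI 3); (Some (- (3 / 64)), KI 4);
            (None, KIII)].
Proof.
move=> r0 t th c.
have LE : L_O r = normal5 (4 * r ^+ 4) (- 28 * r ^+ 2) (- 9 * r ^+ 2) 48 45.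
  exact: L_O_normal.
apply: (@critical_shift_normal5 F _ _ _ _ _ _ (16 * r ^+ 2 / 3) (- 16 / r ^+ 2) _ _
  3%coqZ (-128)%coqZ (-36)%coqZ (-4096)%coqZ (-3840)%coqZ _ _ _ (1 / 64) (- (3 / 64)) 1
    12 LE) => //.
- by normal_form ((3 * 1000 + 840) : F).
- by nonzero.
- by nonzero.
- by nonzero.
- by move=> x /=; split; rewrite !izE; field.
- have -> : quad (iz F 3%coqZ) (iz F (-128)%coqZ) (iz F (-4096)%coqZ) = 3 - 128 * 'X
  - (4 * 1000 + 96) * 'X^2.
    apply: poly_ext => x; rewrite /quad.
    rewrite !(horner_natr, hornerC, hornerZ, hornerXn, hornerX, hornerN, hornerD,
      hornerM) !izE.
    by ring.
  have -> : 'X * lin (iz F (-36)%coqZ) (iz F (-3840)%coqZ) =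
    'X * (- 36 - (3 * 1000 + 840) * 'X).
    apply: poly_ext => x; rewrite /lin.
    rewrite !(horner_natr, hornerC, hornerZ, hornerXn, hornerX, hornerN, hornerD,
      hornerM) !izE.
    by ring.
  exact: integral_solution_O2.
- by nonzero.
- by nonzero.
- by rewrite -subr_eq0 (_ : _ - _ = (1 / 16)); [nonzero|field].
- by rewrite !izE; field.
- by rewrite !izE; field.
by move=> y /=; case=> [<-|[<-|[<-|[<-|[]]]]]; fibre.
Qed.

Lemma critical_shift_I5 (r : F) : r != 0 ->
  let t := pt F in let th := ptheta F in let c := @pcst F in
  critical_shift (L_I r) (fibres_I r) (r ^+ 3)
    (of_theta (2 * th ^+ 2 - t * (59 * th ^+ 2 + 59 * th + 20)
           + 2 ^+ 4 * 3 ^+ 3 * t ^+ 2 * (th + c (5 / 6)) * (th + c (7 / 6))))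
    [:: 1; 10; 120; 1540; 20500; 279480; 3876600; 54496200]%num
    [:: (Some 0, KI 5); (Some (1 / 16), KI 2); (Some (2 / 27), KI 3);
            (None, KII)].
Proof.
move=> r0 t th c.
have LE : L_I r = normal5 (20 * r ^+ 6) (88 * r ^+ 3) (25 * r ^+ 3) (- 108) (- 105).
  exact: L_I_normal.
apply: (@critical_shift_normal5 F _ _ _ _ _ _ (- 16 * r ^+ 3) (1 / (4 * r ^+ 3)) _ _
  2%coqZ (-59)%coqZ (-20)%coqZ 432%coqZ 420%coqZ _ _ _ (1 / 16) (2 / 27) 1 10 LE) => //.
- by normal_form (420 : F).
- by nonzero.
- by nonzero.
- by nonzero.
- by move=> x /=; split; rewrite !izE; field.
- have -> : quad (iz F 2%coqZ) (iz F (-59)%coqZ) (iz F 432%coqZ) = 2 - 59 * 'X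
  + 432 * 'X^2.
    apply: poly_ext => x; rewrite /quad.
    rewrite !(horner_natr, hornerC, hornerZ, hornerXn, hornerX, hornerN, hornerD,
      hornerM) !izE.
    by ring.
  have -> : 'X * lin (iz F (-20)%coqZ) (iz F 420%coqZ) = 'X * (- 20 + 420 * 'X).
    apply: poly_ext => x; rewrite /lin.
    rewrite !(horner_natr, hornerC, hornerZ, hornerXn, hornerX, hornerN, hornerD,
      hornerM) !izE.
    by ring.
  exact: integral_solution_I5.
- by nonzero.
- by nonzero.
- by rewrite -subr_eq0 (_ : _ - _ = - (5 / 432)); [nonzero|field].
- by rewrite !izE; field.
- by rewrite !izE; field.
by move=> y /=; case=> [<-|[<-|[<-|[<-|[]]]]]; fibre.
Qed.

Lemma critical_shift_I3 (r : F) : r != 0 ->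
  let t := pt F in let th := ptheta F in let c := @pcst F in
  critical_shift (L_I r) (fibres_I r) (- 5 * r ^+ 3 / 27)
    (of_theta (10 * th ^+ 2 - 3 * t * (333 * th ^+ 2 + 333 * th + 100)
           + 2 ^+ 4 * 3 ^+ 6 * t ^+ 2 * (th + c (5 / 6)) * (th + c (7 / 6))))
    [:: 1; 30; 1440; 85260; 5606100; 391231080; 28360117800]%num
    [:: (Some 0, KI 3); (Some (2 * 5 / 864), KI 2); (Some (2 / 27), KI 5);
            (None, KII)].
Proof.
move=> r0 t th c.
have LE : L_I r = normal5 (20 * r ^+ 6) (88 * r ^+ 3) (25 * r ^+ 3) (- 108) (- 105).
  exact: L_I_normal.
apply: (@critical_shift_normal5 F _ _ _ _ _ _ (16 * r ^+ 3) (- 27 / (4 * r ^+ 3)) _ _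
  10%coqZ (-999)%coqZ (-300)%coqZ 11664%coqZ 11340%coqZ _ _ _ (2 * 5 / 864) (2 / 27) 1
    30 LE) => //.
- by normal_form ((11 * 1000 + 340) : F).
- by nonzero.
- by nonzero.
- by nonzero.
- by move=> x /=; split; rewrite !izE; field.
- have -> : quad (iz F 10%coqZ) (iz F (-999)%coqZ) (iz F 11664%coqZ) = 10 - 999 * 'X
  + (11 * 1000 + 664) * 'X^2.
    apply: poly_ext => x; rewrite /quad.
    rewrite !(horner_natr, hornerC, hornerZ, hornerXn, hornerX, hornerN, hornerD,
      hornerM) !izE.
    by ring.
  have -> : 'X * lin (iz F (-300)%coqZ) (iz F 11340%coqZ) =
    'X * (- 300 + (11 * 1000 + 340) * 'X).
    apply: poly_ext => x; rewrite /lin.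
    rewrite !(horner_natr, hornerC, hornerZ, hornerXn, hornerX, hornerN, hornerD,
      hornerM) !izE.
    by ring.
  exact: integral_solution_I3.
- by nonzero.
- by nonzero.
- by rewrite -subr_eq0 (_ : _ - _ = - (1 / 16)); [nonzero|field].
- by rewrite !izE; field.
- by rewrite !izE; field.
by move=> y /=; case=> [<-|[<-|[<-|[<-|[]]]]]; fibre.
Qed.

Lemma critical_shift_I2 (r : F) : r != 0 ->
  let t := pt F in let th := ptheta F in let c := @pcst F in
  critical_shift (L_I r) (fibres_I r) 0
    (of_theta (5 * th ^+ 2 - 4 * t * (88 * th ^+ 2 + 88 * th + 25)
           - 2 ^+ 8 * 3 ^+ 3 * t ^+ 2 * (th + c (5 / 6)) * (th + c (7 / 6))))
    [:: 1; 20; 1140; 68240; 4572100; 321427920; 23420014800]%num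
    [:: (Some 0, KI 2); (Some (5 / 432), KI 3); (Some (- (1 / 16)), KI 5);
            (None, KII)].
Proof.
move=> r0 t th c.
have LE : L_I r = normal5 (20 * r ^+ 6) (88 * r ^+ 3) (25 * r ^+ 3) (- 108) (- 105).
  exact: L_I_normal.
apply: (@critical_shift_normal5 F _ _ _ _ _ _ (- 16 * r ^+ 3) (- 4 / r ^+ 3) _ _
  5%coqZ (-352)%coqZ (-100)%coqZ (-6912)%coqZ (-6720)%coqZ _ _ _ (5 / 432) (- (1 / 16))
    1 20 LE) => //.
- by normal_form ((6 * 1000 + 720) : F).
- by nonzero.
- by nonzero.
- by nonzero.
- by move=> x /=; split; rewrite !izE; field.
- have -> : quad (iz F 5%coqZ) (iz F (-352)%coqZ) (iz F (-6912)%coqZ) = 5 - 352 * 'X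
  - (6 * 1000 + 912) * 'X^2.
    apply: poly_ext => x; rewrite /quad.
    rewrite !(horner_natr, hornerC, hornerZ, hornerXn, hornerX, hornerN, hornerD,
      hornerM) !izE.
    by ring.
  have -> : 'X * lin (iz F (-100)%coqZ) (iz F (-6720)%coqZ) =
    'X * (- 100 - (6 * 1000 + 720) * 'X).
    apply: poly_ext => x; rewrite /lin.
    rewrite !(horner_natr, hornerC, hornerZ, hornerXn, hornerX, hornerN, hornerD,
      hornerM) !izE.
    by ring.
  exact: integral_solution_I2.
- by nonzero.
- by nonzero.
- by rewrite -subr_eq0 (_ : _ - _ = (2 / 27)); [nonzero|field].
- by rewrite !izE; field.
- by rewrite !izE; field.
by move=> y /=; case=> [<-|[<-|[<-|[<-|[]]]]]; fibre.
Qed.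

End Platonic.

Theorem mainTheorem5 (R : realType) (r : R[i]) (r_neq0 : r != 0) :
  let t := pt R[i] in
  let th := ptheta R[i] in
  let c := @pcst R[i] in
  [/\ (* tetrahedral *)
    forall rho : R[i], rho ^+ 2 = (r / 3) ^+ 3 ->
    [/\ singular_points (L_T r) (fibres_T rho),
      (* T(3) *)
      critical_shift (L_T r) (fibres_T rho) rho
        (of_theta (2 * th ^+ 2 - 3 * t * (27 * th ^+ 2 + 27 * th + 8)
           + 3 ^+ 6 * t ^+ 2 * (th + c (2 / 3)) * (th + c (4 / 3))))
        [:: 1; 12; 198; 3720; 75690; 1626912; 36376704; 837364176]%num
        [:: (Some 0, KI 3); (Some (1 / 27), KI 2); (Some (2 / 27), KI 3);
            (None, KIV)]
    & (* T(2) *)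
      critical_shift (L_T r) (fibres_T rho) 0
        (of_theta (th ^+ 2
           - 3 ^+ 4 * t ^+ 2 * (th + c (2 / 3)) * (th + c (4 / 3))))
        [:: 1; 0; 18; 0; 810; 0; 45360; 0; 2806650; 0; 183891708; 0]%num
        [:: (Some 0, KI 2); (Some (1 / 9), KI 3); (Some (- (1 / 9)), KI 3);
            (None, KIV)]],
    (* octahedral *)
    [/\ singular_points (L_O r) (fibres_O r),
      (* O(4) *)
      critical_shift (L_O r) (fibres_O r) 0
        (of_theta (3 * th ^+ 2 - 4 * t * (28 * th ^+ 2 + 28 * th + 9)
           + 2 ^+ 10 * t ^+ 2 * (th + c (3 / 4)) * (th + c (5 / 4))))
        [:: 1; 12; 180; 2928; 49860; 875952; 15754704; 288722880]%num
        [:: (Some 0, KI 4); (Some (3 / 64), KI 2); (Some (1 / 16), KI 3);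
            (None, KIII)],
      (* O(3) *)
      critical_shift (L_O r) (fibres_O r) (r ^+ 2 / 3)
        (of_theta (th ^+ 2 - 2 * t * (10 * th ^+ 2 + 10 * th + 3)
           + 2 ^+ 6 * t ^+ 2 * (th + c (3 / 4)) * (th + c (5 / 4))))
        [:: 1; 6; 54; 588; 7110; 91476; 1224636; 16849944; 236523078]%num
        [:: (Some 0, KI 3); (Some (1 / 16), KI 2); (Some (1 / 4), KI 4);
            (None, KIII)]
    & (* O(2) *)
      critical_shift (L_O r) (fibres_O r) (r ^+ 2 / 4)
        (of_theta (3 * th ^+ 2 - 4 * t * (32 * th ^+ 2 + 32 * th + 9)
           - 2 ^+ 12 * t ^+ 2 * (th + c (3 / 4)) * (th + c (5 / 4))))
        [:: 1; 12; 612; 25392; 1298340; 67041072; 3633970704]%num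
        [:: (Some 0, KI 2); (Some (1 / 64), KI 3); (Some (- (3 / 64)), KI 4);
            (None, KIII)]]
  & (* icosahedral *)
    [/\ singular_points (L_I r) (fibres_I r),
      (* I(5) *)
      critical_shift (L_I r) (fibres_I r) (r ^+ 3)
        (of_theta (2 * th ^+ 2 - t * (59 * th ^+ 2 + 59 * th + 20)
           + 2 ^+ 4 * 3 ^+ 3 * t ^+ 2 * (th + c (5 / 6)) * (th + c (7 / 6))))
        [:: 1; 10; 120; 1540; 20500; 279480; 3876600; 54496200]%num
        [:: (Some 0, KI 5); (Some (1 / 16), KI 2); (Some (2 / 27), KI 3);
            (None, KII)],
      (* I(3) *)
      critical_shift (L_I r) (fibres_I r) (- 5 * r ^+ 3 / 27)
        (of_theta (10 * th ^+ 2 - 3 * t * (333 * th ^+ 2 + 333 * th + 100)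
           + 2 ^+ 4 * 3 ^+ 6 * t ^+ 2 * (th + c (5 / 6)) * (th + c (7 / 6))))
        [:: 1; 30; 1440; 85260; 5606100; 391231080; 28360117800]%num
        [:: (Some 0, KI 3); (Some (2 * 5 / 864), KI 2); (Some (2 / 27), KI 5);
            (None, KII)]
    & (* I(2) *)
      critical_shift (L_I r) (fibres_I r) 0
        (of_theta (5 * th ^+ 2 - 4 * t * (88 * th ^+ 2 + 88 * th + 25)
           - 2 ^+ 8 * 3 ^+ 3 * t ^+ 2 * (th + c (5 / 6)) * (th + c (7 / 6))))
        [:: 1; 20; 1140; 68240; 4572100; 321427920; 23420014800]%num
        [:: (Some 0, KI 2); (Some (5 / 432), KI 3); (Some (- (1 / 16)), KI 5);
            (None, KII)]]].
Proof.
move=> t th c; split.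
- move=> rho rhoE; split.
  + exact: singular_points_L_T.
  + exact: critical_shift_T3.
  + exact: critical_shift_T2.
- split.
  + exact: singular_points_L_O.
  + exact: critical_shift_O4.
  + exact: critical_shift_O3.
  + exact: critical_shift_O2.
split.
- exact: singular_points_L_I.
- exact: critical_shift_I5.
- exact: critical_shift_I3.
exact: critical_shift_I2.
Qed.
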